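(* Let $p\in\mathbb{N}$, $T>0$ and $\theta\in[0,1]$ with $\theta\neq\frac12$. Let $u_0\in\mathbb{H}^m(\mathbb{R})$ with $m\ge 0$. Let $u$ be the exact solution of $\partial_t u+\partial_x^{2p+1}u=0$ with $u|_{t=0}=u_0$, let $(v_j^n)$ be the solution of the finite difference $\theta$-scheme with space step $\Delta x>0$ and time step $\Delta t>0$ started from the cell averages of $u_0$, and let $e_j^n=\frac{1}{\Delta x}\int_{x_j}^{x_{j+1}}u(t^n,y)\,dy-v_j^n$ be the convergence error. (i) Consider the forward scheme ($D_\bullet^{2p+1}=D_+^{2p+1}$) if $p$ is odd, respectively the backward scheme ($D_\bullet^{2p+1}=D_-^{2p+1}$) if $p$ is even. Under the CFL condition $\Delta t(1-2\theta)\le \frac{\Delta x^{2p+1}}{2^{2p}}$, $$\|e\|_{\ell^{\infty}(0,N;\ell^2_{\Delta}(\mathbb{Z}))}\lesssim\Delta t^{\frac{\min(m,4p+2)}{4p+2}}\,\|\partial_x^{\min(4p+2,m)}u_0\|_{\mathbb{L}^2(\mathbb{R})}+\Delta x^{\frac{\min(m,2p+2)}{2p+2}}\,\|\partial_x^{\min(2p+2,m)}u_0\|_{\mathbb{L}^2(\mathbb{R})}.$$ (ii) Consider the central scheme ($D_\bullet^{2p+1}=D_c^{2p+1}$), for any $p\in\mathbb{N}$. Under the CFL condition $\Delta t(1-2\theta)\le 2C_0\frac{\Delta x^{4p+2}}{2^{4p}}$, where $C_0>0$ is a fixed constant independent of $\Delta t$ and $\Delta x$, $$\|e\|_{\ell^{\infty}(0,N;\ell^2_{\Delta}(\mathbb{Z}))}\lesssim\Delta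 t^{\frac{\min(m,4p+2)}{4p+2}}\,\|\partial_x^{\min(4p+2,m)}u_0\|_{\mathbb{L}^2(\mathbb{R})}+\Delta x^{2\frac{\min(m,2p+3)}{2p+3}}\,\|\partial_x^{\min(2p+3,m)}u_0\|_{\mathbb{L}^2(\mathbb{R})}.$$
   Context: $\mathbb{N}$ contains $0$. Set $t^n=n\Delta t$ for $n\in\{0,\dots,N\}$ with $N=\lfloor T/\Delta t\rfloor$, and $x_j=j\Delta x$ for $j\in\mathbb{Z}$. The exact solution $u$ is the one given by Fourier transform in $x$: $\widehat{u}(t,\xi)=e^{-t(i\xi)^{2p+1}}\widehat{u_0}(\xi)$. The scheme determines sequences $v^n=(v_j^n)_{j\in\mathbb{Z}}$, square summable in $j$, by $$v_j^{n+1}+\theta\Delta t\,(D_\bullet^{2p+1}v)_j^{n+1}=v_j^n-(1-\theta)\Delta t\,(D_\bullet^{2p+1}v)_j^n,\qquad v_j^0=\frac1{\Delta x}\int_{x_j}^{x_{j+1}}u_0(y)\,dy,$$ where $D_\bullet^{2p+1}$ is one of $$(D_+^{2p+1}v)_j^n=\sum_{k=0}^{2p+1}\frac{\binom{2p+1}{k}(-1)^k}{\Delta x^{2p+1}}v^n_{p-k+j+1}\ \text{(forward)},\qquad (D_-^{2p+1}v)_j^n=\sum_{k=0}^{2p+1}\frac{\binom{2p+1}{k}(-1)^k}{\Delta x^{2p+1}}v^n_{p-k+j}\ \text{(backward)},$$ $$(D_c^{2p+1}v)_j^n=\tfrac12\left(D_+^{2p+1}v+D_-^{2p+1}v\right)_j^n\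 \text{(central)}.$$ $\mathbb{H}^s(\mathbb{R})$ is the Sobolev space with norm $\left(\int_{\mathbb{R}}(1+|\xi|^2)^s|\widehat u(\xi)|^2d\xi\right)^{1/2}$ (so $\mathbb{H}^0=\mathbb{L}^2$). For non-integer $s\geq 0$, $\|\partial_x^s u_0\|_{\mathbb{L}^2(\mathbb{R})}$ denotes the homogeneous norm, i.e. the $\mathbb{L}^2$-norm of the function with Fourier transform $|\xi|^s\widehat{u_0}(\xi)$. Also $\|v\|_{\ell^\infty(0,N;\ell^2_\Delta(\mathbb{Z}))}=\sup_{n\in\{0,\dots,N\}}\left(\sum_{j\in\mathbb{Z}}\Delta x|v_j^n|^2\right)^{1/2}$. The notation $A\lesssim B$ means $A\le CB$ with $C$ a constant independent of $\Delta x$ and $\Delta t$. *)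

(* Defs.v *)
From mathcomp Require Import all_boot all_order all_algebra.
From mathcomp Require Import all_classical all_reals all_analysis.
From mathcomp.real_closed Require Import complex.

Set Implicit Arguments.
Unset Strict Implicit.
Unset Printing Implicit Defensive.

Import Order.TTheory GRing.Theory Num.Theory.
Import numFieldNormedType.Exports.
Local Open Scope classical_set_scope.
Local Open Scope ring_scope.
Local Open Scope complex_scope.

Section Analysis.
Variable R : realType.
Local Notation mu := (@lebesgue_measure R).

Definition cmod (z : R[i]) : R := ComplexField.Normc.normc z.

Definition cexp (z : R[i]) : R[i] :=
  (expR (complex.Re z))%:C * (cos (complex.Im z) +i* sin (complex.Im z)).

Definition cintegral (D : set R) (f : R -> R[i]) : R[i] :=
  (\int[mu]_(x in D) complex.Re (f x)) +i* (\int[mu]_(x in D) complex.Im (f x)).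

Definition L2norm (f : R -> R[i]) : \bar R :=
  ('N[mu]_2%:E [EFin \o (fun x => cmod (f x))])%E.

Definition square_integrable (f : R -> R[i]) : Prop :=
  [/\ measurable_fun setT (fun x => complex.Re (f x)),
      measurable_fun setT (fun x => complex.Im (f x)) & (L2norm f < +oo)%E].

Definition truncated_fourier (A : R) (f : R -> R[i]) (xi : R) : R[i] :=
  ((Num.sqrt (2 * pi))^-1)%:C *
    cintegral `[- A, A] (fun x => f x * cexp (- ('i%C * (x * xi)%:C))).

(* [is_fourier f F]: F is (a representative of) the Fourier transform of the
   L^2 function f. On L^2 the transform is the L^2 limit of the truncated
   integrals. The normalisation (2 pi)^(-1/2) is the unitary one, for which
   the H^0 norm below is the L^2 norm. *)
Definition is_fourier (f F : R -> R[i]) : Prop :=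
  [/\ square_integrable f, square_integrable F &
      L2norm (fun xi => F xi - truncated_fourier A f xi) @[A --> +oo%R]
        --> 0%E].

(* The norms below take the Fourier transform F of a function f:
   [sobolev_norm s F] is the norm of f in H^s. *)
Definition sobolev_norm (s : R) (F : R -> R[i]) : \bar R :=
  ((\int[mu]_xi ((1 + `|xi| ^+ 2) `^ s * cmod (F xi) ^+ 2)%:E) `^ 2^-1)%E.

(* || d_x^s f || in L^2 = H^0: the norm of the function with Fourier transform
   |xi|^s F(xi). For integer s this is the norm of the s-th derivative, whose
   transform (i xi)^s F(xi) has the same modulus. *)
Definition homogeneous_norm (s : R) (F : R -> R[i]) : \bar R :=
  sobolev_norm 0 (fun xi => (`|xi| `^ s)%:C * F xi).

(* u solves d_t u + d_x^(2p+1) u = 0 on [0, T] for an initial datum with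
   Fourier transform u0hat. *)
Definition exact_solution (p : nat) (T : R) (u0hat : R -> R[i])
    (u : R -> R -> R[i]) : Prop :=
  forall t : R, 0 <= t <= T ->
    is_fourier (u t)
      (fun xi => cexp (- (t%:C * ('i%C * xi%:C) ^+ (2 * p + 1))) * u0hat xi).

Definition cell_average (dx : R) (f : R -> R[i]) (j : int) : R[i] :=
  (dx^-1)%:C * cintegral `[j%:~R * dx, (j + 1)%:~R * dx] f.

Definition l2norm (dx : R) (w : int -> R[i]) : \bar R :=
  ((\esum_(j in [set: int]) (dx * cmod (w j) ^+ 2)%:E) `^ 2^-1)%E.

Definition linf_l2norm (N : nat) (dx : R) (w : nat -> int -> R[i]) : \bar R :=
  ereal_sup [set l2norm dx (w n) | n in [set n | (n <= N)%N]].

Definition fd_coef (p : nat) (dx : R) (k : nat) : R[i] :=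
  (('C(2 * p + 1, k))%:R * (-1) ^+ k / dx ^+ (2 * p + 1))%:C.

Definition forward_diff (p : nat) (dx : R) (w : int -> R[i]) (j : int) : R[i] :=
  \sum_(k < (2 * p + 1).+1)
    fd_coef p dx k * w (Posz p - Posz k + j + 1).

Definition backward_diff (p : nat) (dx : R) (w : int -> R[i]) (j : int) : R[i] :=
  \sum_(k < (2 * p + 1).+1)
    fd_coef p dx k * w (Posz p - Posz k + j).

Definition central_diff (p : nat) (dx : R) (w : int -> R[i]) (j : int) : R[i] :=
  2^-1 * (forward_diff p dx w j + backward_diff p dx w j).

Definition nsteps (T dt : R) : nat := Num.truncn (T / dt).

(* v is the solution, up to the last time step, of the theta-scheme for the
   spatial difference operator D, started from the cell averages of u0. *)
Definition scheme_solution (D : (int -> R[i]) -> int -> R[i])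
    (T theta dx dt : R) (u0 : R -> R[i]) (v : nat -> int -> R[i]) : Prop :=
  [/\ forall n, (n <= nsteps T dt)%N -> (l2norm dx (v n) < +oo)%E,
      forall j, v 0%N j = cell_average dx u0 j &
      forall n j, (n < nsteps T dt)%N ->
        v n.+1 j + (theta * dt)%:C * D (v n.+1) j =
        v n j - ((1 - theta) * dt)%:C * D (v n) j].

Definition convergence_error (dx dt : R) (u : R -> R -> R[i])
    (v : nat -> int -> R[i]) (n : nat) (j : int) : R[i] :=
  cell_average dx (u (n%:R * dt)) j - v n j.

End Analysis.

(* Main.v *)
Require Import Defs.
From mathcomp Require Import all_boot all_order all_algebra.
From mathcomp Require Import all_classical all_reals all_analysis.
From mathcomp.real_closed Require Import complex.
From mathcomp Require Import measurable_realfun zify ring lra.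
Import Order.TTheory GRing.Theory Num.Theory.
Import numFieldNormedType.Exports.

(** Let Q F be the sequence of cell averages of the function with Fourier
    transform F. These averages are the inner products of F with the functions
    [chi j], which are orthogonal in L^2, so Bessel's inequality makes Q a
    contraction from L^2 to l^2; and Q turns multiplication by
    [expi (dx * xi)] into the shift of sequences. Hence Q (g^n u0hat), with g
    the amplification factor, solves the scheme exactly, without aliasing
    terms, and it is the only l^2 solution. The error is therefore
    Q ((exp (- t lambda) - g^n) u0hat), and everything reduces to the pointwise
    bound |exp (- t lambda) - g^n| <= C (min (1, dt |xi|^(4p+2)) + min (1, r)),
    with r = dx |xi|^(2p+2) or r = dx^2 |xi|^(2p+3).

    The Fourier analysis on L^2 rests on Abel summation: with the weight
    exp (- e |xi|) every integral is absolutely convergent, the kernel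
    2 e / (e^2 + x^2) is explicit, and its integral over a cell is a difference
    of arctangents, which converges boundedly as e goes to 0. *)

Set Implicit Arguments.
Unset Strict Implicit.
Unset Printing Implicit Defensive.
Local Open Scope classical_set_scope.
Local Open Scope ring_scope.
Local Open Scope complex_scope.

Local Notation Re := complex.Re.
Local Notation Im := complex.Im.

(** * Complex numbers *)

Section ComplexNumbers.
Variable R : realType.
Implicit Types (z w : R[i]) (t s : R).

(** No Plancherel theorem on all of L^2 is used. Its role is played by an Abel-summed identity for
    finite step functions, [pweight_chisum_cvg]: Fatou's lemma extracts from it the upper bound
    behind Bessel's inequality, and comparing two such limits gives the lower bound behind
    uniqueness.

    Uniqueness needs an argument because an implicit step constrains the new sequence only through 1
    + theta dt D. The symbols of D have nonnegative real part, so this operator has a symbol of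
    modulus at least 1, and a localised energy estimate makes it injective on l^2. The same lower
    bound lets denominators be dropped in the error estimates.

    The pointwise bound comes from n <= T / dt local errors of order dt (dt |xi|^(4p+2) + r) at low
    frequency, and from stability alone at high frequency. The upwind symbols dissipate enough to
    absorb the explicit part, so |g| <= 1. The central symbol is purely imaginary, and its CFL
    condition only gives |g| <= 1 + 8 C0 dt, whence a constant with exp (8 C0 T). The fractional
    rates come from min (1, a) <= a^s for s in [0, 1], applied frequency by frequency. *)

Lemma eq_ReIm z w : Re z = Re w -> Im z = Im w -> z = w.
Proof. by case: z => a b; case: w => c d /= -> ->. Qed.

Lemma cReD z w : Re (z + w) = Re z + Re w. Proof. by case: z; case: w. Qed.
Lemma cImD z w : Im (z + w) = Im z + Im w. Proof. by case: z; case: w. Qed.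
Lemma cReN z : Re (- z) = - Re z. Proof. by case: z. Qed.
Lemma cImN z : Im (- z) = - Im z. Proof. by case: z. Qed.
Lemma cReM z w : Re (z * w) = Re z * Re w - Im z * Im w.
Proof. by case: z; case: w. Qed.
Lemma cImM z w : Im (z * w) = Re z * Im w + Im z * Re w.
Proof. by case: z => a b; case: w => c d /=; rewrite addrC. Qed.
Lemma cmod_sqr z : cmod z ^+ 2 = Re z ^+ 2 + Im z ^+ 2.
Proof. by case: z => a b; rewrite /cmod /= sqr_sqrtr// addr_ge0// sqr_ge0. Qed.
Lemma cmod_ge0 z : 0 <= cmod z.
Proof. by case: z => a b; rewrite /cmod /= sqrtr_ge0. Qed.
Lemma cmodM z w : cmod (z * w) = cmod z * cmod w.
Proof. exact: ComplexField.Normc.normcM. Qed.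
Lemma cmodD z w : cmod (z + w) <= cmod z + cmod w.
Proof. exact: (@le_normcD R z w). Qed.
Lemma cmodN z : cmod (- z) = cmod z.
Proof. exact: (@normcN R z). Qed.
Lemma cmod0 : cmod (0 : R[i]) = 0.
Proof. exact: ComplexField.Normc.normc0. Qed.
Lemma cmod1 : cmod (1 : R[i]) = 1.
Proof. exact: ComplexField.Normc.normc1. Qed.
Lemma cmodV z : cmod z^-1 = (cmod z)^-1.
Proof. exact: ComplexField.Normc.normcV. Qed.
Lemma cmodX z n : cmod (z ^+ n) = cmod z ^+ n.
Proof. by elim: n => [|n IH]; rewrite ?expr0 ?cmod1// !exprS cmodM IH. Qed.
Lemma cmod_eq0 z : cmod z = 0 -> z = 0.
Proof. exact: ComplexField.Normc.eq0_normc. Qed.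
Lemma cmodB z w : cmod (z - w) <= cmod z + cmod w.
Proof. by rewrite (le_trans (cmodD _ _))// cmodN. Qed.
Lemma cmod_real t : cmod t%:C = `|t|.
Proof. by rewrite /cmod /= expr0n /= addr0 sqrtr_sqr. Qed.
Lemma normr_Re z : `|Re z| <= cmod z.
Proof.
rewrite -(@ler_pXn2r _ 2)// ?nnegrE ?cmod_ge0//.
by rewrite real_normK ?num_real// cmod_sqr lerDl sqr_ge0.
Qed.
Lemma normr_Im z : `|Im z| <= cmod z.
Proof.
rewrite -(@ler_pXn2r _ 2)// ?nnegrE ?cmod_ge0//.
by rewrite real_normK ?num_real// cmod_sqr lerDr sqr_ge0.
Qed.
Lemma cmod_ReIm z : cmod z <= `|Re z| + `|Im z|.
Proof.
rewrite -(@ler_pXn2r _ 2)// ?nnegrE ?cmod_ge0 ?addr_ge0//.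
rewrite cmod_sqr sqrrD !real_normK ?num_real// lerD2r lerDl.
by rewrite mulrn_wge0// mulr_ge0.
Qed.
Lemma cmod_conj z : cmod z^* = cmod z.
Proof. by case: z => a b; rewrite /cmod /= sqrrN. Qed.
Lemma mulr_conj z : z * z^* = (cmod z ^+ 2)%:C.
Proof.
rewrite cmod_sqr; case: z => a b; apply: eq_ReIm => /=; last by ring.
by rewrite mulrN opprK.
Qed.

Definition expi t : R[i] := cos t +i* sin t.

Lemma expi0 : expi 0 = 1.
Proof. by rewrite /expi cos0 sin0. Qed.
Lemma expiD t s : expi (t + s) = expi t * expi s.
Proof.
by apply: eq_ReIm; rewrite ?cReM ?cImM /= ?cosD ?sinD//; ring.
Qed.
Lemma cmod_expi t : cmod (expi t) = 1.
Proof. by rewrite /cmod /= cos2Dsin2 sqrtr1. Qed.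
Lemma expiMn t n : expi (n%:R * t) = expi t ^+ n.
Proof.
elim: n => [|n IH]; first by rewrite mul0r expi0 expr0.
by rewrite -natr1 mulrDl mul1r expiD IH exprSr.
Qed.
Lemma cexp_imag t : cexp ('i%C * t%:C) = expi t.
Proof.
by rewrite /cexp; apply: eq_ReIm;
  rewrite !(cReM, cImM) /= !(mul0r, mul1r, add0r, subr0, mulr0, oppr0, expR0, addr0).
Qed.

End ComplexNumbers.

(** * Measurability of complex functions, by real and imaginary parts *)

Section ComplexMeasurable.
Context (R : realType) d (T : measurableType d).
Implicit Types f g : T -> R[i].

Definition cmeas f :=
  measurable_fun setT (fun x => Re (f x)) /\
  measurable_fun setT (fun x => Im (f x)).

Lemma cmeas_real (h : T -> R) :
  measurable_fun setT h -> cmeas (fun x => (h x)%:C).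
Proof. by move=> mh; split => //=; exact: measurable_cst. Qed.
Lemma cmeas_cst (c : R[i]) : cmeas (fun=> c).
Proof. by split; exact: measurable_cst. Qed.
Lemma cmeasD f g : cmeas f -> cmeas g -> cmeas (fun x => f x + g x).
Proof.
move=> [a b] [c e]; split.
  by under eq_fun do rewrite cReD; exact: measurable_funD.
by under eq_fun do rewrite cImD; exact: measurable_funD.
Qed.
Lemma cmeasM f g : cmeas f -> cmeas g -> cmeas (fun x => f x * g x).
Proof.
move=> [a b] [c e]; split.
  under eq_fun do rewrite cReM.
  by apply: measurable_funB; exact: measurable_funM.
under eq_fun do rewrite cImM.
by apply: measurable_funD; exact: measurable_funM.
Qed.
Lemma cmeas_conj f : cmeas f -> cmeas (fun x => (f x)^*).
Proof.
move=> [a b]; split.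
  by rewrite (_ : (fun x => _) = fun x => Re (f x))//; apply/funext => x; case: (f x).
rewrite (_ : (fun x => _) = fun x => - Im (f x)); first exact: measurableT_comp.
by apply/funext => x; case: (f x).
Qed.
Lemma cmeasB f g : cmeas f -> cmeas g -> cmeas (fun x => f x - g x).
Proof.
move=> mf mg; rewrite (_ : (fun x => _) = fun x => f x + (-1) * g x).
  by apply: cmeasD => //; apply: cmeasM => //; exact: cmeas_cst.
by apply/funext => x; rewrite mulN1r.
Qed.
Lemma cmeas_sum I (r : seq I) (F : I -> T -> R[i]) :
  (forall i, cmeas (F i)) -> cmeas (fun x => \sum_(i <- r) F i x).
Proof.
move=> mF; elim: r => [|i r IH].
  by under eq_fun do rewrite big_nil; exact: cmeas_cst.
by under eq_fun do rewrite big_cons; exact: cmeasD.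
Qed.
Lemma cmeasX f n : cmeas f -> cmeas (fun x => f x ^+ n).
Proof.
move=> mf; elim: n => [|n IH]; first exact: cmeas_cst.
by under eq_fun do rewrite exprS; exact: cmeasM.
Qed.
Lemma cmeas_cmod2 f : cmeas f -> measurable_fun setT (fun x => cmod (f x) ^+ 2).
Proof.
move=> [a b]; under eq_fun do rewrite cmod_sqr.
by apply: measurable_funD; exact: measurable_funX.
Qed.
Lemma cmeas_cmod f : cmeas f -> measurable_fun setT (fun x => cmod (f x)).
Proof.
move=> /cmeas_cmod2 mf.
rewrite (_ : (fun x => _) = fun x => Num.sqrt (cmod (f x) ^+ 2)).
  apply: (measurableT_comp (f := @Num.sqrt R)) => //.
  by apply: continuous_measurable_fun => x; exact: sqrt_continuous.
by apply/funext => x; rewrite sqrtr_sqr ger0_norm// cmod_ge0.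
Qed.
(** The inverse is conj z / |z|^2, a formula that also holds at z = 0 because the inverse of 0 is 0
    by convention. *)
Lemma cmeasV f : cmeas f -> cmeas (fun x => (f x)^-1).
Proof.
move=> mf; rewrite (_ : (fun x => _) =
    fun x => ((cmod (f x) ^+ 2)^-1)%:C * (f x)^*).
  apply: cmeasM; last exact: cmeas_conj.
  apply: cmeas_real.
  under eq_fun do rewrite -powR_inv1 ?sqr_ge0//.
  exact: measurableT_comp (measurable_powR _) (cmeas_cmod2 mf).
apply/funext => x; have [->|f0] := eqVneq (f x) 0.
  by rewrite invr0 cmod0 expr0n /= invr0 rmorph0 mul0r.
have c0 : cmod (f x) ^+ 2 != 0.
  by rewrite expf_eq0/=; apply: contraNN f0 => /eqP /cmod_eq0 ->.
apply: (mulfI f0); rewrite mulfV// mulrCA mulr_conj.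
by rewrite -rmorphM mulVf.
Qed.
Lemma cmeas_expi (h : T -> R) :
  measurable_fun setT h -> cmeas (fun x => expi (h x)).
Proof.
move=> mh; split => /=.
  by apply: measurableT_comp => //; apply: continuous_measurable_fun;
    exact: continuous_cos.
by apply: measurableT_comp => //; apply: continuous_measurable_fun;
  exact: continuous_sin.
Qed.

End ComplexMeasurable.

Lemma cmeas_comp (R : realType) d1 d2 (T1 : measurableType d1)
    (T2 : measurableType d2) (f : T2 -> R[i]) (h : T1 -> T2) :
  cmeas f -> measurable_fun setT h -> cmeas (fun x => f (h x)).
Proof.
move=> [a b] mh; split.
  exact: (measurableT_comp (f := fun x => Re (f x)) a mh).
exact: (measurableT_comp (f := fun x => Im (f x)) b mh).
Qed.

(** * Integrals of complex functions *)

Section ComplexIntegral.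
Variable R : realType.
Local Notation mu := (@lebesgue_measure R).
Implicit Types f g : R -> R[i].

Definition cint f : R[i] := cintegral setT f.

Definition cintegrable f :=
  mu.-integrable setT (EFin \o (fun x => Re (f x))) /\
  mu.-integrable setT (EFin \o (fun x => Im (f x))).

Lemma cintegrable_cmeas f : cintegrable f -> cmeas f.
Proof. by move=> [/measurable_int/measurable_EFinP a /measurable_int/measurable_EFinP b]. Qed.

Lemma le_integrable_real (h g : R -> R) :
  measurable_fun setT h -> (forall x, `|h x| <= g x) ->
  mu.-integrable setT (EFin \o g) -> mu.-integrable setT (EFin \o h).
Proof.
move=> mh hg; apply: le_integrable => //; first exact/measurable_EFinP.
by move=> x _ /=; rewrite lee_fin (le_trans (hg x))// ler_norm.
Qed.

Lemma cintegrable_le f (g : R -> R) : cmeas f -> (forall x, cmod (f x) <= g x) ->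
  mu.-integrable setT (EFin \o g) -> cintegrable f.
Proof.
move=> [mf1 mf2] fg ig; split.
  by apply: le_integrable_real ig => // x; rewrite (le_trans (normr_Re _)).
by apply: le_integrable_real ig => // x; rewrite (le_trans (normr_Im _)).
Qed.

Lemma integrable_cmod f : cintegrable f ->
  mu.-integrable setT (EFin \o (fun x => cmod (f x))).
Proof.
move=> fi; have [ia ib] := fi.
have := integrableD measurableT (integrable_norm ia) (integrable_norm ib).
apply: le_integrable => //.
  by apply/measurable_EFinP; apply: cmeas_cmod; exact: cintegrable_cmeas.
move=> x _; rewrite /= lee_fin ger0_norm ?cmod_ge0// (ger0_norm (addr_ge0 _ _))//.
exact: cmod_ReIm.
Qed.

Lemma cintegrableD f g : cintegrable f -> cintegrable g ->
  cintegrable (fun x => f x + g x).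
Proof.
move=> fi gi; apply: (@cintegrable_le _ (fun x => cmod (f x) + cmod (g x))).
- by apply: cmeasD; exact: cintegrable_cmeas.
- by move=> x; exact: cmodD.
exact: (integrableD measurableT (integrable_cmod fi) (integrable_cmod gi)).
Qed.

Lemma cintegrableM f g (M : R) : cintegrable f -> cmeas g ->
  (forall x, cmod (g x) <= M) -> cintegrable (fun x => f x * g x).
Proof.
move=> fi mg gM; apply: (@cintegrable_le _ (fun x => M * cmod (f x))).
- by apply: cmeasM => //; exact: cintegrable_cmeas.
- by move=> x; rewrite cmodM mulrC ler_wpM2r// cmod_ge0.
exact: (integrableZl measurableT M (integrable_cmod fi)).
Qed.

Lemma cintegrableZ f (c : R[i]) : cintegrable f -> cintegrable (fun x => c * f x).
Proof.
move=> fi; under eq_fun do rewrite mulrC.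
by apply: (@cintegrableM _ _ (cmod c)) => //; exact: cmeas_cst.
Qed.

Lemma cintegrable0 : cintegrable (fun=> 0).
Proof. by split; exact: integrable0. Qed.

Lemma cintegrable_sum I (r : seq I) (F : I -> R -> R[i]) :
  (forall i, cintegrable (F i)) -> cintegrable (fun x => \sum_(i <- r) F i x).
Proof.
move=> iF; elim: r => [|i r IH].
  by under eq_fun do rewrite big_nil; exact: cintegrable0.
by under eq_fun do rewrite big_cons; exact: cintegrableD.
Qed.

Lemma cintegrable_real (h : R -> R) :
  mu.-integrable setT (EFin \o h) -> cintegrable (fun x => (h x)%:C).
Proof. by move=> ih; split => //=; exact: integrable0. Qed.

Lemma cint_real (h : R -> R) : cint (fun x => (h x)%:C) = (\int[mu]_x h x)%:C.
Proof. by rewrite /cint /cintegral /= Rintegral_cst// mul0r. Qed.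

Lemma cintD f g : cintegrable f -> cintegrable g ->
  cint (fun x => f x + g x) = cint f + cint g.
Proof.
move=> [f1 f2] [g1 g2]; apply: eq_ReIm => /=.
  by under eq_Rintegral do rewrite cReD; rewrite RintegralD.
by under eq_Rintegral do rewrite cImD; rewrite RintegralD.
Qed.

Lemma cintZ f c : cintegrable f -> cint (fun x => c * f x) = c * cint f.
Proof.
move=> [f1 f2]; have iZ k (h : R -> R) : mu.-integrable setT (EFin \o h) ->
    mu.-integrable setT (EFin \o (fun x => k * h x)).
  by move=> hi; exact: (integrableZl measurableT k hi).
apply: eq_ReIm; rewrite ?cReM ?cImM /=.
  under eq_Rintegral do rewrite cReM.
  by rewrite RintegralB// ?RintegralZl//; exact: iZ.
under eq_Rintegral do rewrite cImM.
by rewrite RintegralD// ?RintegralZl//; exact: iZ.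
Qed.

Lemma cint_sum I (r : seq I) (F : I -> R -> R[i]) :
  (forall i, cintegrable (F i)) ->
  cint (fun x => \sum_(i <- r) F i x) = \sum_(i <- r) cint (F i).
Proof.
move=> iF; elim: r => [|i r IH].
  rewrite big_nil; under eq_fun do rewrite big_nil.
  by rewrite (cint_real (fun=> 0)) Rintegral_cst// mul0r.
rewrite big_cons -IH -cintD//; first by under eq_fun do rewrite big_cons.
exact: cintegrable_sum.
Qed.

Lemma normr_Re_cint f (g : R -> R) : cintegrable f ->
  (forall x, cmod (f x) <= g x) -> mu.-integrable setT (EFin \o g) ->
  `|Re (cint f)| <= \int[mu]_x g x.
Proof.
move=> [f1 f2] fg gi; apply: le_trans (le_normr_Rintegral measurableT f1) _.
apply: le_Rintegral => //; first exact: integrable_norm.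
by move=> x _; exact: le_trans (normr_Re _) _.
Qed.

Lemma normr_Im_cint f (g : R -> R) : cintegrable f ->
  (forall x, cmod (f x) <= g x) -> mu.-integrable setT (EFin \o g) ->
  `|Im (cint f)| <= \int[mu]_x g x.
Proof.
move=> [f1 f2] fg gi; apply: le_trans (le_normr_Rintegral measurableT f2) _.
apply: le_Rintegral => //; first exact: integrable_norm.
by move=> x _; exact: le_trans (normr_Im _) _.
Qed.

(** Bounding the two components separately costs a factor 2. This is harmless where only boundedness
    of a transform is wanted; Bessel's inequality needs the sharp constant and uses
    [normr_Re_cint]. *)
Lemma cmod_cint f (g : R -> R) : cintegrable f ->
  (forall x, cmod (f x) <= g x) -> mu.-integrable setT (EFin \o g) ->
  cmod (cint f) <= 2 * \int[mu]_x g x.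
Proof.
move=> fi fg gi; rewrite (le_trans (cmod_ReIm _))// mulr_natl mulr2n.
by rewrite lerD// ?normr_Re_cint// normr_Im_cint.
Qed.

(** * Fubini for products f(x) w(y) k(x, y) with f and w integrable and |k| <= 1 *)

Section Fubini.
Variables (f w : R -> R[i]) (k : R * R -> R[i]).
Hypotheses (fi : cintegrable f) (wi : cintegrable w) (mk : cmeas k)
  (k1 : forall z, cmod (k z) <= 1).

Let K (z : R * R) := f z.1 * w z.2 * k z.

Let mK : cmeas K.
Proof.
apply: cmeasM => //; apply: cmeasM.
  by apply: cmeas_comp (cintegrable_cmeas fi) _; exact: measurable_fst.
by apply: cmeas_comp (cintegrable_cmeas wi) _; exact: measurable_snd.
Qed.

Let Kle x y : cmod (K (x, y)) <= cmod (f x) * cmod (w y).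
Proof. by rewrite !cmodM /= ler_piMr// mulr_ge0// cmod_ge0. Qed.

Let iprod (h : R * R -> R) : measurable_fun setT h ->
  (forall x y, `|h (x, y)| <= cmod (f x) * cmod (w y)) ->
  (mu \x mu)%E.-integrable setT (EFin \o h).
Proof.
move=> mh hle; apply/integrable12ltyP; first exact/measurable_EFinP.
have ifn := integrable_cmod fi; have iwn := integrable_cmod wi.
have hb x : (\int[mu]_y `|(h (x, y))%:E| <=
    (cmod (f x))%:E * (\int[mu]_y cmod (w y))%:E)%E.
  apply: (@le_trans _ _ (\int[mu]_y ((cmod (f x))%:E * (cmod (w y))%:E))%E).
    apply: ge0_le_integral => //=.
    - apply/measurable_EFinP.
      exact: measurableT_comp (measurableT_comp mh (measurable_pair1 x)).
    - apply/measurable_EFinP; apply: measurable_funM => //.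
      exact: cmeas_cmod (cintegrable_cmeas wi).
    - by move=> y _; rewrite -EFinM lee_fin.
  rewrite integralZl// /Rintegral fineK//.
  exact: (integrable_fin_num measurableT iwn).
apply: (@le_lt_trans _ _ (\int[mu]_x ((cmod (f x))%:E * (\int[mu]_y cmod (w y))%:E))%E).
  apply: ge0_le_integral => //=.
  - by move=> x _; exact: integral_ge0.
  - have mabs : measurable_fun setT (fun z => `|(h z)%:E|%E).
      by apply/measurable_EFinP; exact: measurableT_comp.
    exact: (measurable_fun_fubini_tonelli_F (m2:=mu) _ mabs (fun z => abse_ge0 _)).
  - apply/measurable_EFinP; apply: measurable_funM => //.
    exact: cmeas_cmod (cintegrable_cmeas fi).
  - by move=> x _; exact: hb.
exact: (integrable_lty measurableT
  (integrableZr measurableT (\int[mu]_y cmod (w y)) ifn)).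
Qed.

Let iRe : (mu \x mu)%E.-integrable setT (EFin \o (fun z => Re (K z))).
Proof.
by apply: iprod => [|x y]; [exact: mK.1|exact: le_trans (normr_Re _) (Kle _ _)].
Qed.
Let iIm : (mu \x mu)%E.-integrable setT (EFin \o (fun z => Im (K z))).
Proof.
by apply: iprod => [|x y]; [exact: mK.2|exact: le_trans (normr_Im _) (Kle _ _)].
Qed.

Lemma cmeas_section1 x : cmeas (fun y => k (x, y)).
Proof. by apply: cmeas_comp => //; exact: measurable_pair1. Qed.
Lemma cmeas_section2 y : cmeas (fun x => k (x, y)).
Proof. by apply: cmeas_comp => //; exact: measurable_pair2. Qed.

Let E1 x : f x * cint (fun y => w y * k (x, y)) = cint (fun y => K (x, y)).
Proof.
rewrite -cintZ; first by congr cint; apply/funext => y; rewrite /K mulrA.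
by apply: (@cintegrableM _ _ 1) => //; exact: cmeas_section1.
Qed.
Let E2 y : w y * cint (fun x => f x * k (x, y)) = cint (fun x => K (x, y)).
Proof.
rewrite -cintZ; first by congr cint; apply/funext => x; rewrite /K mulrA (mulrC (w y)).
by apply: (@cintegrableM _ _ 1) => //; exact: cmeas_section2.
Qed.

Lemma cint_fubini : cint (fun x => f x * cint (fun y => w y * k (x, y))) =
                    cint (fun y => w y * cint (fun x => f x * k (x, y))).
Proof.
under eq_fun do rewrite E1; under [in RHS]eq_fun do rewrite E2.
have F (h : R * R -> R) : (mu \x mu)%E.-integrable setT (EFin \o h) ->
    \int[mu]_x \int[mu]_y h (x, y) = \int[mu]_y \int[mu]_x h (x, y).
  move=> ih; rewrite /Rintegral; congr fine.
  (* [Rintegral] applies [fine] to the inner integral, which is known to be finite only for almost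
     every [x]; outside a null set [fine] loses nothing. *)
  have ax : ae_eq mu setT (fun x => (fine (\int[mu]_y (h (x, y))%:E))%:E)
      (fun x => \int[mu]_y (h (x, y))%:E)%E.
    apply: filterS (ae_integrable1 ih) => x /= ihx _.
    by rewrite fineK//; exact: (integrable_fin_num measurableT ihx).
  have ay : ae_eq mu setT (fun y => (fine (\int[mu]_x (h (x, y))%:E))%:E)
      (fun y => \int[mu]_x (h (x, y))%:E)%E.
    apply: filterS (ae_integrable2 ih) => y /= ihy _.
    by rewrite fineK//; exact: (integrable_fin_num measurableT ihy).
  have mx := measurable_fubini_F ih; have my := measurable_fubini_G ih.
  rewrite (ae_eq_integral _ _ _ _ _ ax)//; last first.
    by apply/measurable_EFinP; apply: measurableT_comp mx; exact: fine_measurable.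
  rewrite (ae_eq_integral _ _ _ _ _ ay)//; last first.
    by apply/measurable_EFinP; apply: measurableT_comp my; exact: fine_measurable.
  exact: (Fubini ih).
have cintE (H : R -> R -> R[i]) : cint (fun x => cint (H x)) =
    (\int[mu]_x \int[mu]_y Re (H x y)) +i* (\int[mu]_x \int[mu]_y Im (H x y)).
  by [].
rewrite (cintE (fun x y => K (x, y))) (cintE (fun y x => K (x, y))).
by rewrite (F _ iRe) (F _ iIm).
Qed.

Lemma cmeas_cint_section : cmeas (fun y => w y * cint (fun x => f x * k (x, y))).
Proof.
under eq_fun do rewrite E2; split => /=.
  apply: measurableT_comp (measurable_fubini_G iRe).
  exact: fine_measurable.
apply: measurableT_comp (measurable_fubini_G iIm).
exact: fine_measurable.
Qed.

Lemma cmod_cint_section y :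
  cmod (cint (fun x => f x * k (x, y))) <= 2 * \int[mu]_x cmod (f x).
Proof.
apply: cmod_cint; last exact: integrable_cmod.
  by apply: (@cintegrableM _ _ 1) => //; exact: cmeas_section2.
by move=> x; rewrite cmodM ler_piMr// cmod_ge0.
Qed.

End Fubini.

End ComplexIntegral.

(** * The Poisson kernel *)

Section PoissonKernel.
Variable R : realType.
Local Notation mu := (@lebesgue_measure R).

(** Folding at 0 leads to a half-line, where [pweight] is a plain exponential and the fundamental
    theorem applies. Nonnegativity makes this legitimate before integrability is known. *)
Lemma ge0_integral_fold (G : R -> R) : (forall x, 0 <= G x) -> continuous G ->
  (\int[mu]_x (G x)%:E =
   \int[mu]_(x in `[0%R, +oo[) (G x + G (- x))%:E)%E.
Proof.
move=> G0 cG; have mG := continuous_measurable_fun cG.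
have mpos : measurable [set x : R | 0 <= x] by rewrite -set_itvcy.
rewrite -(setUv [set x : R | 0 <= x]%R) ge0_integral_setU//= ; last 4 first.
- exact: measurableC.
- by apply/measurable_EFinP; rewrite setUv.
- by move=> x _; rewrite lee_fin.
- exact/disj_setPCl.
rewrite -set_itvcy// setCitvr.
rewrite integral_itv_bndo_bndc; last exact/measurable_EFinP/measurable_funTS.
have := @ge0_integration_by_substitutionNy R G 0; rewrite oppr0 => ->//; last first.
  exact: continuous_subspaceT.
rewrite -ge0_integralD//=.
- by move=> x _; rewrite lee_fin.
- exact/measurable_EFinP/measurable_funTS.
- by move=> x _; rewrite lee_fin.
- apply/measurable_EFinP/measurable_funTS; apply: measurableT_comp => //.
Qed.

Definition pweight (e x : R) : R := expR (- (e * `|x|)).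

Lemma pweight_gt0 e x : 0 < pweight e x. Proof. exact: expR_gt0. Qed.

Lemma continuous_pweight e : continuous (pweight e).
Proof.
move=> x; apply: (continuous_comp (f := fun x : R => - (e * `|x|))); last first.
  exact: continuous_expR.
apply: continuousN; apply: continuousM; first exact: cst_continuous.
exact: norm_continuous.
Qed.

(** The summand 1 keeps the integrand nonnegative, so that the fundamental theorem on the half-line
    needs no prior integrability. The case z = 0 then shows that the weight is integrable, after
    which the contribution of the 1 can be subtracted. *)
Lemma integral_pweight_cos (e z : R) : 0 < e ->
  (\int[mu]_x (pweight e x * (1 + cos (z * x)))%:E =
   (2 / e + 2 * e / (e ^+ 2 + z ^+ 2))%:E)%E.
Proof.
move=> e0; have cw : continuous (pweight e) by exact: continuous_pweight.
have czx : continuous (fun x : R => cos (z * x)).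
  move=> x; apply: (continuous_comp (f := *%R z)); last exact: continuous_cos.
  exact: mulrl_continuous.
have ez : e ^+ 2 + z ^+ 2 != 0.
  by rewrite gt_eqF// ltr_pwDl// ?exprn_gt0// sqr_ge0.
rewrite ge0_integral_fold; last 2 first.
- by move=> x; rewrite mulr_ge0 ?(ltW (pweight_gt0 _ _))// -lerBlDl sub0r cos_geN1.
- move=> x; apply: continuousM; first exact: cw.
  by apply: continuousD; [exact: cst_continuous|exact: czx].
pose f (x : R) : R := 2 * (expR (- (e * x)) * (1 + cos (z * x))).
(* Twice the real part of a primitive of exp ((- e + i z) x) + exp (- e x). *)
pose F (x : R) : R := expR (- (e * x)) *
  (2 * (z * sin (z * x) - e * cos (z * x)) / (e ^+ 2 + z ^+ 2) - 2 / e).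
have dF (x : R) : is_derive x 1 F (f x).
  have d1 : is_derive x (1:R) (fun x : R => expR (- (e * x))) (expR (- (e * x)) * - e).
    have := @is_derive1_comp R expR (fun x : R => - (e * x)) x (expR (- (e * x))) (- e).
    move=> h; apply: h; apply: is_derive_eq; by rewrite scaler1 ?mulr1.
  have d0 : is_derive x (1:R) (fun x : R => z * x) z.
    by apply: is_derive_eq; rewrite scaler1 ?mulr1.
  have d2 : is_derive x (1:R) (fun x : R => sin (z * x)) (cos (z * x) * z).
    exact: is_derive1_comp.
  have d3 : is_derive x (1:R) (fun x : R => cos (z * x)) (- sin (z * x) * z).
    exact: is_derive1_comp.
  apply: is_derive_eq; rewrite /GRing.scale /= /f; field; rewrite ez ?gt_eqF//.
have cf : continuous f.
  move=> x; apply: (@continuousM R R (cst 2)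
    (fun y : R => expR (- (e * y)) * (1 + cos (z * y)))); first exact: cst_continuous.
  apply: continuousM.
    apply: (continuous_comp (f := fun x : R => - (e * x))); last first.
      exact: continuous_expR.
    apply: continuousN; exact: mulrl_continuous.
  by apply: continuousD; [exact: cst_continuous|exact: czx].
have Fy : F x @[x --> +oo] --> (0 : R).
  apply/cvgrPdist_le => d d0; near=> x.
  rewrite sub0r normrN /F normrM ger0_norm ?expR_ge0//.
  have x0 : 0 < x by near: x; apply: nbhs_pinfty_gt; exact: num_real.
  set h := (X in `|X|); pose M : R := 2 * (`|z| + e) / (e ^+ 2 + z ^+ 2) + 2 / e.
  have M0 : 0 < M.
    by rewrite ltr_wpDl ?divr_gt0// divr_ge0 ?mulr_ge0 ?addr_ge0 ?sqr_ge0 ?(ltW e0).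
  have hM : `|h| <= M.
    rewrite (le_trans (ler_normB _ _))// lerD//; last first.
      by rewrite ger0_norm// divr_ge0// ltW.
    rewrite !normrM normfV (ger0_norm (_ : 0 <= 2))//.
    rewrite (@ger0_norm _ (e ^+ 2 + _)) ?addr_ge0 ?sqr_ge0// ler_wpM2r//.
      by rewrite invr_ge0 addr_ge0 ?sqr_ge0.
    rewrite ler_wpM2l// (le_trans (ler_normB _ _))// !normrM (gtr0_norm e0) lerD//.
      by rewrite ler_piMr// sin_max.
    by rewrite ler_piMr ?(ltW e0)// cos_max.
  rewrite (@le_trans _ _ ((1 + e * x)^-1 * M))//.
    rewrite ler_pM ?expR_ge0// expRN lef_pV2 ?posrE ?expR_gt0 ?ltr_wpDr ?mulr_ge0 ?(ltW e0) ?(ltW x0)//.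
    exact: expR_ge1Dx.
  rewrite ler_pdivrMl ?ltr_wpDr ?mulr_ge0 ?(ltW e0) ?(ltW x0)//.
  have xM : M / (e * d) <= x by near: x; apply: nbhs_pinfty_ge; exact: num_real.
  move: xM; rewrite ler_pdivrMr ?mulr_gt0// => xM.
  by rewrite (le_trans xM)// mulrDl mul1r (mulrC x) mulrAC ler_wpDl// ltW.
rewrite (_ : (\int[mu]_(x in _) _)%E = \int[mu]_(x in `[0%R, +oo[) (f x)%:E)%E; last first.
  apply: eq_integral => x; rewrite inE /= in_itv /= andbT => x0.
  by rewrite /pweight normrN ger0_norm// /f mulrN cosN; congr EFin; ring.
rewrite (@ge0_continuous_FTC2y R f F 0 0) //.
- rewrite /F !mulr0 oppr0 expR0 sin0 cos0 mul1r -EFinN -EFinD; congr EFin.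
  field; rewrite ez gt_eqF//.
- by move=> x _; rewrite /f !mulr_ge0 ?expR_ge0// -lerBlDl sub0r cos_geN1.
- exact: continuous_subspaceT.
- apply: cvg_at_right_filter.
  by apply: differentiable_continuous; apply/derivable1_diffP.
- by move=> x _; rewrite derive1E; exact: derive_val.
Unshelve. all: by end_near. Qed.


Lemma measurable_pweight e : measurable_fun setT (pweight e).
Proof. by apply: continuous_measurable_fun; exact: continuous_pweight. Qed.

Lemma integrable_pweight e : 0 < e -> mu.-integrable setT (EFin \o pweight e).
Proof.
move=> e0; have := integral_pweight_cos 0 e0.
under eq_integral do rewrite mul0r cos0 EFinM.
have mw : measurable_fun setT (EFin \o pweight e).
  by apply/measurable_EFinP; exact: measurable_pweight.
rewrite ge0_integralZr//; last first.
  by move=> x _; rewrite lee_fin ltW// pweight_gt0.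
move=> h; apply/integrableP; split => //.
under eq_integral do rewrite gee0_abs ?lee_fin ?ltW ?pweight_gt0//.
move: h; case: (\int[mu]_x _)%E => //= [r _|]; first exact: ltry.
by rewrite gt0_mulye// lte_fin.
Qed.

Lemma integrable_pweightM e (h : R -> R) : 0 < e ->
  measurable_fun setT h -> (forall x, `|h x| <= 1) ->
  mu.-integrable setT (EFin \o (fun x => pweight e x * h x)).
Proof.
move=> e0 mh h1; apply: le_integrable_real (integrable_pweight e0).
  by apply: measurable_funM => //; exact: measurable_pweight.
move=> x; rewrite normrM ger0_norm ?(ltW (pweight_gt0 _ _))//.
by rewrite ler_piMr// ltW// pweight_gt0.
Qed.

Lemma cint_pweight e z : 0 < e ->
  cint (fun x => (pweight e x)%:C * expi (z * x)) =
  (2 * e / (e ^+ 2 + z ^+ 2))%:C.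
Proof.
move=> e0; have iw := integrable_pweight e0.
have mz (g : R -> R) : continuous g -> measurable_fun setT (fun x : R => g (z * x)).
  move=> cg; apply: measurableT_comp; last exact: mulrl_measurable.
  exact: continuous_measurable_fun.
have ic : mu.-integrable setT (EFin \o (fun x => pweight e x * cos (z * x))).
  apply: integrable_pweightM => //; last by move=> x; exact: cos_max.
  by apply: mz; exact: continuous_cos.
have is_ : mu.-integrable setT (EFin \o (fun x => pweight e x * sin (z * x))).
  apply: integrable_pweightM => //; last by move=> x; exact: sin_max.
  by apply: mz; exact: continuous_sin.
have w1 (g : R -> R) : mu.-integrable setT (EFin \o (fun x => pweight e x * g x)) ->
    \int[mu]_x (pweight e x * (1 + g x)) =
    \int[mu]_x pweight e x + \int[mu]_x (pweight e x * g x).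
  by move=> ig; rewrite -RintegralD//; apply: eq_Rintegral => x _; ring.
have Iw : \int[mu]_x pweight e x = 2 / e.
  have := integral_pweight_cos 0 e0 => /(congr1 fine) /=.
  rewrite -/(Rintegral _ _ _) expr0n /= addr0 => h.
  have : \int[mu]_x (pweight e x * 2) = 2 * (2 / e).
    rewrite (_ : \int[mu]_x _ = \int[mu]_x (pweight e x * (1 + cos (0 * x)))).
      by rewrite h; field; rewrite gt_eqF.
    by apply: eq_Rintegral => x _; rewrite mul0r cos0.
  rewrite RintegralZr// mulrC => /mulfI; apply.
  by [].
apply: eq_ReIm => /=.
  transitivity (\int[mu]_x (pweight e x * cos (z * x))).
    by apply: eq_Rintegral => x _ /=; rewrite mul0r subr0.
  have := integral_pweight_cos z e0 => /(congr1 fine) /=.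
  by rewrite -/(Rintegral _ _ _) w1// Iw => /addrI.
transitivity (\int[mu]_x (pweight e x * sin (z * x))).
  by apply: eq_Rintegral => x _ /=; rewrite mul0r addr0.
(* The sine integral vanishes by oddness, but folding requires a nonnegative integrand; hence the
   weight is added on both sides first. *)
apply: (addrI (\int[mu]_x pweight e x)); rewrite -w1// addr0.
congr fine.
have cw : continuous (pweight e) by exact: continuous_pweight.
have s0 x : 0 <= pweight e x * (1 + sin (z * x)).
  by rewrite mulr_ge0 ?(ltW (pweight_gt0 _ _))// -lerBlDl sub0r sin_geN1.
have cs : continuous (fun x : R => pweight e x * (1 + sin (z * x))).
  move=> x; apply: continuousM; first exact: cw.
  apply: continuousD; first exact: cst_continuous.
  apply: (continuous_comp (f := *%R z)); last exact: continuous_sin.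
  exact: mulrl_continuous.
rewrite (ge0_integral_fold s0 cs).
rewrite (ge0_integral_fold (fun x => ltW (pweight_gt0 e x)) cw).
apply: eq_integral => x _; rewrite /pweight normrN mulrN sinN; congr EFin.
by ring.
Qed.

End PoissonKernel.

(** * Fourier transforms of cells *)

Section FourierCells.
Variable R : realType.
Local Notation mu := (@lebesgue_measure R).
Implicit Types (f : R -> R[i]) (k : R * R -> R[i]).

Lemma cintegrable_pweight e : 0 < e -> cintegrable (fun x : R => (pweight e x)%:C).
Proof. by move=> e0; apply: cintegrable_real; exact: integrable_pweight. Qed.

(** Fubini yields measurability only after multiplication by an integrable function of [y]. The
    weight [pweight 1] serves for this and, being positive, can be divided out again. *)
Lemma cmeas_cint f k : cintegrable f -> cmeas k -> (forall z, cmod (k z) <= 1) ->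
  cmeas (fun y => cint (fun x => f x * k (x, y))).
Proof.
move=> fi mk k1.
have h := cmeas_cint_section fi (cintegrable_pweight (ltr01 : 0 < 1)) mk k1.
have wn0 y : (pweight 1 y)%:C != 0 :> R[i].
  by rewrite fmorph_eq0 gt_eqF// pweight_gt0.
rewrite (_ : (fun y => _) = fun y => ((pweight 1 y)%:C)^-1 *
    ((pweight 1 y)%:C * cint (fun x => f x * k (x, y)))).
  apply: cmeasM => //; apply: cmeasV; apply: cmeas_real.
  exact: measurable_pweight.
by apply/funext => y; rewrite mulrA mulVf// mul1r.
Qed.

(** Unnormalised, unlike [truncated_fourier]; the missing factor is the inverse of [sq2pi]. *)
Definition fourier f (xi : R) : R[i] := cint (fun x => f x * expi (- (x * xi))).

Lemma cmeas_expi_prod (s : R) :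
  cmeas (fun z : R * R => expi (s * (z.1 * z.2)) : R[i]).
Proof.
apply: cmeas_expi; apply: measurable_funM => //.
by apply: measurable_funM; [exact: measurable_fst|exact: measurable_snd].
Qed.

Lemma cmeas_fourier f : cintegrable f -> cmeas (fourier f).
Proof.
move=> fi; have := @cmeas_cint f (fun z => expi (- (z.1 * z.2))) fi.
apply; last by move=> z; rewrite cmod_expi.
by have := cmeas_expi_prod (-1); under eq_fun do rewrite mulN1r.
Qed.

Lemma cmod_fourier f xi : cintegrable f ->
  cmod (fourier f xi) <= 2 * \int[mu]_x cmod (f x).
Proof.
move=> fi; apply: (@cmod_cint_section R f (fun z => expi (- (z.1 * z.2))) fi).
  by have := cmeas_expi_prod (-1); under eq_fun do rewrite mulN1r.
by move=> z; rewrite cmod_expi.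
Qed.

Definition cell (a h x : R) : R[i] := (\1_(`[a, a + h[%classic) x)%:C.

Lemma cintegrable_cell a h : cintegrable (cell a h).
Proof.
apply: cintegrable_real.
exact: (integrable_indic_itv a (a + h) true true).
Qed.

(* The conjugate of the Fourier transform of the indicator of [a, a + h[. *)
Definition cellhat (a h xi : R) : R[i] :=
  cint (fun y => cell 0 h y * expi ((a + y) * xi)).

Lemma cmeas_cellk a : cmeas (fun z : R * R => expi ((a + z.1) * z.2) : R[i]).
Proof.
apply: cmeas_expi; apply: measurable_funM; last exact: measurable_snd.
by apply: measurable_funD => //; exact: measurable_fst.
Qed.

Lemma cmeas_cellhat a h : cmeas (cellhat a h).
Proof.
apply: (@cmeas_cint _ (fun z => expi ((a + z.1) * z.2))).
- exact: cintegrable_cell.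
- exact: cmeas_cellk.
- by move=> z; rewrite cmod_expi.
Qed.

Lemma cellhat_bounded a h : exists M, forall xi, cmod (cellhat a h xi) <= M.
Proof.
exists (2 * \int[mu]_x cmod (cell 0 h x)) => xi.
apply: (@cmod_cint_section R _ (fun z => expi ((a + z.1) * z.2))).
- exact: cintegrable_cell.
- exact: cmeas_cellk.
- by move=> z; rewrite cmod_expi.
Qed.

(** Since [cellhat] keeps the position of the cell in the phase, a translation is a constant factor
    pulled out of the integral, without change of variables. The change of variables is paid for
    once, in [fourier_cell]. *)
Lemma cellhatD a b h xi : cellhat (a + b) h xi = expi (a * xi) * cellhat b h xi.
Proof.
rewrite /cellhat -cintZ.
  by congr cint; apply/funext => y; rewrite mulrCA -expiD; congr (_ * expi _); ring.
apply: (@cintegrableM _ _ _ 1).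
- exact: cintegrable_cell.
- by apply: cmeas_expi; apply: measurable_funM => //; apply: measurable_funD.
- by move=> x; rewrite cmod_expi.
Qed.

Lemma integral_pkernel (e a h x : R) : 0 < e -> 0 < h ->
  \int[mu]_(y in `[0, h[) (2 * e / (e ^+ 2 + (a + y - x) ^+ 2)) =
  2 * (atan ((a + h - x) / e) - atan ((a - x) / e)).
Proof.
move=> e0 h0.
pose f (y : R) : R := 2 * e / (e ^+ 2 + (a + y - x) ^+ 2).
pose F (y : R) : R := 2 * atan ((a + y - x) / e).
have dF (y : R) : is_derive y 1 F (f y).
  have d1 : is_derive y (1:R) (fun y : R => (a + y - x) / e) e^-1.
    by apply: is_derive_eq; rewrite /GRing.scale /=; ring.
  have d2 : is_derive y (1:R) (fun y : R => atan ((a + y - x) / e))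
      ((1 + ((a + y - x) / e) ^+ 2)^-1 * e^-1).
    exact: is_derive1_comp.
  apply: is_derive_eq; rewrite /GRing.scale /= /f.
  have p : e ^+ 2 + (a + y - x) ^+ 2 != 0.
    by rewrite gt_eqF// ltr_pwDl// ?exprn_gt0// sqr_ge0.
  by field; rewrite p gt_eqF.
have cF : continuous F.
  by move=> y; apply: differentiable_continuous; apply/derivable1_diffP.
have cf : continuous f.
  move=> y; apply: cvgM; first exact: cvg_cst.
  apply: cvgV; first by rewrite gt_eqF// ltr_pwDl// ?exprn_gt0// sqr_ge0.
  apply: cvgD; first exact: cvg_cst.
  apply: (continuous_comp (f := fun y : R => a + y - x) (g := fun t : R => t ^+ 2)).
    by apply: cvgB; [apply: cvgD; [exact: cvg_cst|exact: cvg_id]|exact: cvg_cst].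
  exact: exprn_continuous.
rewrite Rintegral_itv_bndo_bndc; last first.
  apply: (@integrableS _ _ _ mu `[0, h]%classic) => //.
    by apply: subset_itvl; rewrite bnd_simp.
  apply: continuous_compact_integrable; first exact: segment_compact.
  exact: continuous_subspaceT.
rewrite /Rintegral (@continuous_FTC2 R f F 0 h)//=.
- by rewrite /F addr0 mulrBr.
- exact: continuous_subspaceT.
- split => //.
  + by apply: cvg_at_right_filter; exact: cF.
  + by apply: cvg_at_left_filter; exact: cF.
- by move=> y _; rewrite derive1E; exact: derive_val.
Qed.

(** Fubini is used twice: once to bring the integral over [x] outside, where the factor exp (- i x
    xi) moves the cell to a - x, and once to exchange [xi] with the cell variable [y]. The innermost
    integral is then the Poisson kernel at a - x + y, whose integral over the cell is the difference
    of arctangents. *)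
Lemma cint_fourier_cell (e a h : R) f : 0 < e -> 0 < h -> cintegrable f ->
  cint (fun xi => (pweight e xi)%:C * (fourier f xi * cellhat a h xi)) =
  cint (fun x => f x *
    (2 * (atan ((a + h - x) / e) - atan ((a - x) / e)))%:C).
Proof.
move=> e0 h0 fi.
have [M hM] := cellhat_bounded a h.
have iw' : cintegrable (fun xi => (pweight e xi)%:C * cellhat a h xi).
  apply: (cintegrableM (cintegrable_pweight e0) (cmeas_cellhat a h) hM).
have mk : cmeas (fun z : R * R => expi (- (z.1 * z.2)) : R[i]).
  by have := cmeas_expi_prod (-1); under eq_fun do rewrite mulN1r.
have k1 z : cmod ((fun z : R * R => expi (- (z.1 * z.2)) : R[i]) z) <= 1.
  by rewrite cmod_expi.
have := cint_fubini fi iw' mk k1 => /= fub.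
transitivity (cint (fun y => (pweight e y)%:C * cellhat a h y *
    cint (fun x => f x * expi (- (x * y))))).
  by congr cint; apply/funext => xi; rewrite mulrA mulrAC.
rewrite -fub; congr cint; apply/funext => x; congr (_ * _).
transitivity (cint (fun xi => (pweight e xi)%:C *
    cint (fun y => cell 0 h y * expi ((a - x + y) * xi)))).
  congr cint; apply/funext => xi; rewrite -mulrA; congr (_ * _).
  rewrite -/(cellhat (a - x) h xi) addrC cellhatD mulrC; congr (expi _ * _).
  by rewrite mulNr.
have k1' z : cmod ((fun z : R * R => expi ((a - x + z.1) * z.2) : R[i]) z) <= 1.
  by rewrite cmod_expi.
rewrite -(cint_fubini (cintegrable_cell 0 h) (cintegrable_pweight e0)
  (cmeas_cellk (a - x)) k1') /=.
transitivity (cint (fun y => (\1_(`[0, 0 + h[%classic) y *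
    (2 * e / (e ^+ 2 + (a - x + y) ^+ 2)))%:C)).
  congr cint; apply/funext => y; rewrite (cint_pweight (a - x + y) e0).
  exact/esym/rmorphM.
rewrite cint_real -(integral_pkernel a x e0 h0) [in RHS]Rintegral_mkcond.
apply: (congr1 (fun r : R => r%:C)); apply: eq_Rintegral => y _.
rewrite add0r patchE indicE addrAC.
by case: (_ \in _); rewrite ?mul0r ?mul1r.
Qed.

End FourierCells.

Section ComplexLimits.
Variable R : realType.
Implicit Types (u v : nat -> R[i]) (l m c : R[i]).

(** Convergence is taken by components so that the limit theorems for real integrals apply
    directly. *)
Definition ccvg u l :=
  ((fun n => Re (u n)) @ \oo --> Re l) /\ ((fun n => Im (u n)) @ \oo --> Im l).

Lemma ccvg_unique u l m : ccvg u l -> ccvg u m -> l = m.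
Proof.
move=> [a b] [c e]; apply: eq_ReIm.
  exact: (cvg_unique (@norm_hausdorff R R^o) a c).
exact: (cvg_unique (@norm_hausdorff R R^o) b e).
Qed.

Lemma ccvgD u v l m : ccvg u l -> ccvg v m -> ccvg (fun n => u n + v n) (l + m).
Proof.
move=> [a b] [c e]; split.
  by under eq_fun do rewrite cReD; rewrite cReD; exact: cvgD.
by under eq_fun do rewrite cImD; rewrite cImD; exact: cvgD.
Qed.

Lemma ccvgZ c u l : ccvg u l -> ccvg (fun n => c * u n) (c * l).
Proof.
move=> [a b]; split.
  under eq_fun do rewrite cReM; rewrite cReM.
  by apply: cvgB; apply: cvgM => //; exact: cvg_cst.
under eq_fun do rewrite cImM; rewrite cImM.
by apply: cvgD; apply: cvgM => //; exact: cvg_cst.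
Qed.

Lemma ccvg_sum I (r : seq I) (F : I -> nat -> R[i]) (L : I -> R[i]) :
  (forall i, ccvg (F i) (L i)) ->
  ccvg (fun n => \sum_(i <- r) F i n) (\sum_(i <- r) L i).
Proof.
move=> FL; elim: r => [|i r IH].
  rewrite big_nil; under eq_fun do rewrite big_nil.
  by split; exact: cvg_cst.
by rewrite big_cons; under eq_fun do rewrite big_cons; exact: ccvgD.
Qed.

End ComplexLimits.

(** * The Abel limit of the pairing of a transform with a cell *)

Section CellLimit.
Variable R : realType.
Local Notation mu := (@lebesgue_measure R).
Implicit Types (f : R -> R[i]).

Lemma cvg_atan_scale (c : R) : 0 < c ->
  atan (c * n.+1%:R) @[n --> \oo] --> pi / 2.
Proof.
move=> c0; apply: (cvg_comp (fun n => c * n.+1%:R : R) (@atan R)); last exact: cvgy_atan.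
apply/cvgryPge => A; near=> n.
rewrite mulrC -ler_pdivrMr//; apply: (@le_trans _ _ n%:R); last by rewrite ler_nat.
by near: n; exact: nbhs_infty_ger.
Unshelve. all: by end_near. Qed.

(** Inside the cell the two arctangents tend to opposite limits, outside to the same one. At the two
    endpoints the limit is pi instead, which is why they are excluded; they form a null set in the
    dominated convergence that follows. *)
Lemma cvg_pkernel (a h x : R) : 0 < h -> x != a -> x != a + h ->
  2 * (atan ((a + h - x) / n.+1%:R^-1) - atan ((a - x) / n.+1%:R^-1))
    @[n --> \oo] --> (2 * pi) * (\1_(`[a, a + h[%classic) x : R).
Proof.
move=> h0 xa xah; under eq_fun do rewrite !invrK.
have Natan (c : R) : c < 0 -> atan (c * n.+1%:R) @[n --> \oo] --> - (pi / 2).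
  move=> c0; rewrite (_ : (fun n => _) = fun n => - atan ((- c) * n.+1%:R)).
    by apply: cvgN; apply: cvg_atan_scale; rewrite oppr_gt0.
  by apply/funext => n; rewrite mulNr atanN opprK.
rewrite indicE; case: (boolP (x \in _)); rewrite ?(inE, notin_setE) /= in_itv /=.
  move=> /andP[ax xh]; rewrite mulr1.
  have -> : 2 * pi = 2 * (pi / 2 - - (pi / 2)) :> R by field.
  apply: cvgM; first exact: cvg_cst.
  apply: cvgB; [apply: cvg_atan_scale|apply: Natan]; rewrite ?subr_gt0//.
  by rewrite subr_lt0 lt_neqAle eq_sym xa.
move=> xI; rewrite mulr0.
have [xlta|] := ltP x a.
  have -> : 0 = 2 * (pi / 2 - pi / 2) :> R by rewrite subrr mulr0.
  apply: cvgM; first exact: cvg_cst.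
  apply: cvgB; apply: cvg_atan_scale; rewrite subr_gt0//.
  by rewrite (lt_trans xlta)// ltrDl.
move=> ax; have hx : a + h < x.
  by rewrite lt_neqAle eq_sym xah/= leNgt; apply/negP => xh; apply: xI; rewrite ax.
have -> : 0 = 2 * (- (pi / 2) - - (pi / 2)) :> R by rewrite subrr mulr0.
apply: cvgM; first exact: cvg_cst.
apply: cvgB; apply: Natan; rewrite subr_lt0//.
by rewrite lt_neqAle eq_sym xa.
Qed.

Lemma cvg_integral_pkernel (g : R -> R) (a h : R) : 0 < h ->
  mu.-integrable setT (EFin \o g) ->
  \int[mu]_x (g x * (2 * (atan ((a + h - x) / n.+1%:R^-1) -
                          atan ((a - x) / n.+1%:R^-1)))) @[n --> \oo] -->
  \int[mu]_x (g x * ((2 * pi) * \1_(`[a, a + h[%classic) x)).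
Proof.
move=> h0 gi.
have mg : measurable_fun setT g by apply/measurable_EFinP; exact: measurable_int gi.
pose A n x : R := 2 * (atan ((a + h - x) / n.+1%:R^-1) - atan ((a - x) / n.+1%:R^-1)).
have matan (b : R) n : measurable_fun setT (fun x : R => atan ((b - x) / n.+1%:R^-1)).
  apply: measurableT_comp.
    by apply: continuous_measurable_fun => x; exact: continuous_atan.
  by apply: measurable_funM => //; apply: measurable_funB.
have mA n : measurable_fun setT (A n).
  by apply: measurable_funM => //; apply: measurable_funB.
have A2 n x : `|A n x| <= 2 * pi.
  rewrite /A normrM (ger0_norm (_ : 0 <= 2))// ler_wpM2l//.
  have := atan_gtNpi2 ((a + h - x) / n.+1%:R^-1).
  have := atan_ltpi2 ((a + h - x) / n.+1%:R^-1).
  have := atan_gtNpi2 ((a - x) / n.+1%:R^-1).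
  have := atan_ltpi2 ((a - x) / n.+1%:R^-1).
  rewrite ler_norml; lra.
have ig : mu.-integrable setT (EFin \o (fun x => 2 * pi * `|g x|)).
  exact: (integrableZl measurableT (2 * pi) (integrable_norm gi)).
have [] := @dominated_convergence _ _ _ mu setT measurableT
  (fun n x => (g x * A n x)%:E)
  (fun x => (g x * ((2 * pi) * \1_(`[a, a + h[%classic) x))%:E) _ _ _ _ ig.
- by move=> n; apply/measurable_EFinP; exact: measurable_funM mg (mA n).
- apply/measurable_EFinP; apply: (measurable_funM mg).
  apply: measurable_funM; first exact: measurable_cst.
  exact: measurable_indic (measurable_itv _).
- exists [set a; a + h]; split.
  + by apply: measurableU; exact: measurable_set1.
  + rewrite measureU0//; exact: lebesgue_measure_set1.
  + move=> x /= /not_implyP [_]; apply: contra_notP => /not_orP [/eqP xa /eqP xh].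
    apply: cvg_EFin; first exact: nearW.
    apply: cvgM; first exact: cvg_cst.
    exact: cvg_pkernel.
- apply: aeW => x n _; rewrite /= lee_fin normrM mulrC ler_wpM2r//.
move=> iG _ cG; apply: fine_cvg; rewrite fineK//.
exact: (integrable_fin_num measurableT iG).
Qed.

(** Parseval's identity between an integrable function and a cell. The product on the Fourier side
    need not be integrable here, so the identity is stated as an Abel limit. *)
Lemma ccvg_fourier_cell f (a h : R) : 0 < h -> cintegrable f ->
  ccvg (fun n => cint (fun xi => (pweight n.+1%:R^-1 xi)%:C *
          (fourier f xi * cellhat a h xi)))
       ((2 * pi)%:C * cint (fun x => f x * cell a h x)).
Proof.
move=> h0 fi.
have icell : cintegrable (fun x => f x * cell a h x).
  apply: (@cintegrableM _ _ _ 1) => //.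
    exact: cintegrable_cmeas (cintegrable_cell a h).
  move=> x; by rewrite cmod_real indicE; case: (_ \in _); rewrite ?normr0 ?normr1 ?lexx ?ler01.
rewrite -cintZ//; under eq_fun do rewrite cint_fourier_cell ?invr_gt0//.
split=> /=.
  under eq_fun do under eq_Rintegral do rewrite cReM /= mulr0 subr0.
  under eq_Rintegral => x _.
    rewrite cReM /= mul0r subr0 cReM /= mulr0 subr0 mulrCA; over.
  exact: cvg_integral_pkernel fi.1.
under eq_fun do under eq_Rintegral do rewrite cImM /= mulr0 add0r.
under eq_Rintegral => x _.
  rewrite cImM /= mul0r addr0 cImM /= mulr0 add0r mulrCA; over.
exact: cvg_integral_pkernel fi.2.
Qed.

End CellLimit.

(** * Transforms of translated cells, and orthogonality of the cells *)

Section CellSystem.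
Variable R : realType.
Local Notation mu := (@lebesgue_measure R).
Implicit Types (f F : R -> R[i]).

Lemma Rintegral_FTC (g G : R -> R) (a h : R) : 0 < h -> continuous g ->
  (forall x : R, is_derive x 1 G (g x)) ->
  \int[mu]_(x in `[a, a + h[) g x = G (a + h) - G a.
Proof.
move=> h0 cg dG; have ah : a < a + h by rewrite ltrDl.
have cG : continuous G.
  by move=> y; apply: differentiable_continuous; apply/derivable1_diffP.
rewrite Rintegral_itv_bndo_bndc; last first.
  apply: (@integrableS _ _ _ mu `[a, a + h]%classic) => //.
    by apply: subset_itvl; rewrite bnd_simp.
  apply: continuous_compact_integrable; first exact: segment_compact.
  exact: continuous_subspaceT.
rewrite /Rintegral (@continuous_FTC2 R g G a (a + h))//=.
- exact: continuous_subspaceT.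
- split => //.
  + by apply: cvg_at_right_filter; exact: cG.
  + by apply: cvg_at_left_filter; exact: cG.
- by move=> y _; rewrite derive1E; exact: derive_val.
Qed.

(** Both sides equal G (a + h) - G a. Having a primitive at hand is no restriction, as only cosines
    and sines are translated. *)
Lemma Rintegral_translate (g G : R -> R) (a h : R) : 0 < h -> continuous g ->
  (forall x : R, is_derive x 1 G (g x)) ->
  \int[mu]_(x in `[a, a + h[) g x = \int[mu]_(y in `[0, 0 + h[) g (a + y).
Proof.
move=> h0 cg dG; rewrite (Rintegral_FTC a h0 cg dG).
have cg' : continuous (fun y => g (a + y)).
  move=> y; apply: (continuous_comp (f := +%R a)); last exact: cg.
  by apply: cvgD; [exact: cvg_cst|exact: cvg_id].
have dG' (y : R) : is_derive y 1 (fun y => G (a + y)) (g (a + y)).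
  rewrite -[g (a + y)]mulr1; apply: is_derive1_comp.
  by apply: is_derive_eq; rewrite add0r.
by rewrite (Rintegral_FTC 0 h0 cg' dG') !add0r addr0.
Qed.

Lemma cos_sin_antiderivative (xi : R) : exists Gc Gs : R -> R,
  (forall x : R, is_derive x 1 Gc (cos (x * xi))) /\
  (forall x : R, is_derive x 1 Gs (sin (x * xi))).
Proof.
have [->|xi0] := eqVneq xi 0.
  exists id, (cst 0); split=> x; rewrite mulr0 ?cos0 ?sin0; exact: is_derive_eq.
have d0 (x : R) : is_derive x (1:R) (fun x : R => x * xi) xi.
  by apply: is_derive_eq; rewrite /GRing.scale /=; ring.
exists (fun x => sin (x * xi) / xi), (fun x => - (cos (x * xi) / xi)); split=> x.
  have d1 : is_derive x (1:R) (fun x : R => sin (x * xi)) (cos (x * xi) * xi).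
    exact: is_derive1_comp.
  by apply: is_derive_eq; rewrite /GRing.scale /=; field.
have d1 : is_derive x (1:R) (fun x : R => cos (x * xi)) (- sin (x * xi) * xi).
  exact: is_derive1_comp.
by apply: is_derive_eq; rewrite /GRing.scale /=; field.
Qed.

Lemma Re_cint_cell (a h : R) (f : R -> R[i]) :
  Re (cint (fun x => cell a h x * f x)) = \int[mu]_(x in `[a, a + h[) Re (f x).
Proof.
rewrite /= [RHS]Rintegral_mkcond; apply: eq_Rintegral => x _.
rewrite cReM /= mul0r subr0 patchE indicE.
by case: ifPn => _; rewrite ?mul0r// mul1r.
Qed.

Lemma Im_cint_cell (a h : R) (f : R -> R[i]) :
  Im (cint (fun x => cell a h x * f x)) = \int[mu]_(x in `[a, a + h[) Im (f x).
Proof.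
rewrite /= [RHS]Rintegral_mkcond; apply: eq_Rintegral => x _.
rewrite cImM /= mul0r addr0 patchE indicE.
by case: ifPn => _; rewrite ?mul0r// mul1r.
Qed.

Lemma fourier_cell (a h xi : R) : 0 < h ->
  fourier (cell a h) xi = (cellhat a h xi)^*.
Proof.
move=> h0; have [Gc [Gs [dc ds]]] := cos_sin_antiderivative xi.
have cx : continuous (fun x : R => x * xi) by exact: mulrr_continuous.
have cc : continuous (fun x : R => cos (x * xi)).
  move=> x; apply: (continuous_comp (f := fun x : R => x * xi)); first exact: cx.
  exact: continuous_cos.
have cs : continuous (fun x : R => sin (x * xi)).
  move=> x; apply: (continuous_comp (f := fun x : R => x * xi)); first exact: cx.
  exact: continuous_sin.
have Rec (z : R[i]) : Re z^* = Re z by case: z.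
have Imc (z : R[i]) : Im z^* = - Im z by case: z.
have E : fourier (cell a h) xi = (cint (fun x => cell a h x * expi (x * xi)))^*.
  apply: eq_ReIm; rewrite ?Rec ?Imc.
    by rewrite !Re_cint_cell; apply: eq_Rintegral => x _ /=; rewrite cosN.
  rewrite !Im_cint_cell /= -mulN1r -RintegralZl//.
    by apply: eq_Rintegral => x _ /=; rewrite sinN mulN1r.
  apply: (@integrableS _ _ _ mu `[a, a + h]%classic) => //.
    by apply: subset_itvl; rewrite bnd_simp.
  apply: continuous_compact_integrable; first exact: segment_compact.
  exact: continuous_subspaceT.
rewrite E; congr (_^*); apply: eq_ReIm.
  rewrite !Re_cint_cell /=; exact: Rintegral_translate dc.
rewrite !Im_cint_cell /=; exact: Rintegral_translate ds.
Qed.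

Variable dx : R.
Hypothesis dx0 : 0 < dx.

Definition jcell (j : int) : R -> R[i] := cell (j%:~R * dx) dx.
Definition chi (j : int) : R -> R[i] := cellhat (j%:~R * dx) dx.

Lemma chiD (l j : int) xi : chi (l + j) xi = expi (l%:~R * (dx * xi)) * chi j xi.
Proof. by rewrite /chi intrD mulrDl cellhatD mulrA. Qed.

Lemma cmeas_chi j : cmeas (chi j). Proof. exact: cmeas_cellhat. Qed.

Lemma cint_jcellM (j k : int) :
  cint (fun x => jcell j x * jcell k x) = (if j == k then dx else 0)%:C.
Proof.
(* A point of the half-open cell [l] has floor (x / dx) = l, so cells with different indices are
   disjoint. *)
have mem (l : int) (x : R) : x \in `[l%:~R * dx, l%:~R * dx + dx[%classic ->
    (l <= Num.floor (x / dx)) /\ (Num.floor (x / dx) < l + 1).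
  rewrite inE /= in_itv /= => /andP[h1 h2]; rewrite floor_ge_int floor_lt_int.
  rewrite ler_pdivlMr// ltr_pdivrMr// intrD mulrDl mul1r; split=> //.
have [->|jk] := eqVneq j k.
  transitivity (cint (fun x => jcell k x * (1%:C))); last first.
    apply: eq_ReIm; rewrite ?Re_cint_cell ?Im_cint_cell /=.
      rewrite Rintegral_cst// mul1r.
      have /(congr1 fine) := lebesgue_measure_itv `[k%:~R * dx, k%:~R * dx + dx[.
      by rewrite /= lte_fin ltrDl dx0 -EFinB /= addrAC subrr add0r.
    by rewrite Rintegral_cst// mul0r.
  congr cint; apply/funext => x; rewrite /jcell /cell -!rmorphM indicE.
  by case: (_ \in _); rewrite /= ?mulr1n ?mulr0n ?mulr0 ?mul0r ?mulr1.
rewrite (_ : (fun x => _) = fun=> (0 : R)%:C).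
  by rewrite (cint_real (fun=> 0)) Rintegral_cst// mul0r.
apply/funext => x; rewrite /jcell /cell -rmorphM !indicE.
case: (boolP (x \in _)) => [/mem [a b]|_]; last by rewrite mul0r.
case: (boolP (x \in _)) => [/mem [c d]|_]; last by rewrite mulr0.
by exfalso; move: jk => /eqP; apply; apply/eqP; rewrite eq_le; apply/andP; split;
  rewrite -ltzD1; [exact: le_lt_trans a d|exact: le_lt_trans c b].
Qed.

End CellSystem.

(** * Bessel's inequality *)

Section Bessel.
Variable R : realType.
Local Notation mu := (@lebesgue_measure R).
Implicit Types (f F G : R -> R[i]).

Definition csqint F := cmeas F /\
  mu.-integrable setT (EFin \o (fun x => cmod (F x) ^+ 2)).

(** Young's inequality takes the place of Cauchy-Schwarz. The value t = 1 gives integrability of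
    products; t = [sq2pi] balances the two terms in [bessel_seq]. *)
Lemma mulr_cmod_le (z w : R[i]) (t : R) : 0 < t ->
  cmod (z * w) <= 2^-1 * (t * cmod z ^+ 2 + t^-1 * cmod w ^+ 2).
Proof.
move=> t0; rewrite cmodM; have tn : t != 0 by rewrite gt_eqF.
have : 0 <= (t * cmod z - cmod w) ^+ 2 / t by rewrite divr_ge0 ?sqr_ge0 ?ltW.
have -> : (t * cmod z - cmod w) ^+ 2 / t =
    t * cmod z ^+ 2 + t^-1 * cmod w ^+ 2 - 2 * (cmod z * cmod w).
  by field.
by lra.
Qed.

Lemma integrable_mulr_cmod F G (t s : R) : csqint F -> csqint G ->
  mu.-integrable setT (EFin \o
    (fun x => 2^-1 * (t * cmod (F x) ^+ 2 + s * cmod (G x) ^+ 2))).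
Proof.
move=> [_ iF] [_ iG].
exact: (integrableZl measurableT 2^-1 (integrableD measurableT
  (integrableZl measurableT t iF) (integrableZl measurableT s iG))).
Qed.

Lemma csqintM F G : csqint F -> csqint G -> cintegrable (fun x => F x * G x).
Proof.
move=> sF sG; apply: (@cintegrable_le _ _
  (fun x => 2^-1 * (1 * cmod (F x) ^+ 2 + 1^-1 * cmod (G x) ^+ 2))).
- exact: cmeasM sF.1 sG.1.
- by move=> x; exact: mulr_cmod_le.
exact: integrable_mulr_cmod.
Qed.

Lemma csqint_le F G (C : R) : cmeas F -> (forall x, cmod (F x) <= C * cmod (G x)) ->
  csqint G -> csqint F.
Proof.
move=> mF FG [mG iG]; split=> //.
apply: (@le_integrable_real _ _ (fun x => C ^+ 2 * cmod (G x) ^+ 2)).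
- exact: cmeas_cmod2.
- move=> x; rewrite ger0_norm ?sqr_ge0// -exprMn.
  by rewrite lerXn2r ?nnegrE ?cmod_ge0// (le_trans (cmod_ge0 (F x))).
exact: (integrableZl measurableT (C ^+ 2) iG).
Qed.

Lemma csqintD F G : csqint F -> csqint G -> csqint (fun x => F x + G x).
Proof.
move=> [mF iF] [mG iG]; split; first exact: cmeasD.
apply: (@le_integrable_real _ _ (fun x => 2 * (cmod (F x) ^+ 2 + cmod (G x) ^+ 2))).
- by apply: cmeas_cmod2; exact: cmeasD.
- move=> x; rewrite ger0_norm ?sqr_ge0//.
  apply: (@le_trans _ _ ((cmod (F x) + cmod (G x)) ^+ 2)).
    by rewrite lerXn2r ?nnegrE ?addr_ge0 ?cmod_ge0// cmodD.
  rewrite -subr_ge0 (_ : _ - _ = (cmod (F x) - cmod (G x)) ^+ 2) ?sqr_ge0//.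
  by ring.
exact: (integrableZl measurableT 2 (integrableD measurableT iF iG)).
Qed.

Lemma csqintZ c F : csqint F -> csqint (fun x => c * F x).
Proof.
move=> sF; apply: (csqint_le (C := cmod c) _ _ sF) => [|x].
  by apply: cmeasM; [exact: cmeas_cst|exact: sF.1].
by rewrite cmodM.
Qed.

Lemma csqint_conj F : csqint F -> csqint (fun x => (F x)^*).
Proof.
move=> sF; apply: (csqint_le (C := 1) _ _ sF) => [|x].
  by apply: cmeas_conj; exact: sF.1.
by rewrite cmod_conj mul1r.
Qed.

Lemma cvg_pweight (x : R) : pweight n.+1%:R^-1 x @[n --> \oo] --> (1 : R).
Proof.
rewrite /pweight -[X in _ --> X]expR0; apply: continuous_cvg; first exact: continuous_expR.
rewrite -[X in _ --> X]oppr0; apply: cvgN; rewrite -(mul0r `|x|).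
by apply: cvgM; [exact: cvg_harmonic|exact: cvg_cst].
Qed.

Lemma pweight_le1 (n : nat) (x : R) : pweight n.+1%:R^-1 x <= 1.
Proof. by rewrite /pweight expR_le1 oppr_le0 mulr_ge0. Qed.

Lemma ccvg_pweight G : cintegrable G ->
  ccvg (fun n => cint (fun x => (pweight n.+1%:R^-1 x)%:C * G x)) (cint G).
Proof.
move=> iG; have mG := cintegrable_cmeas iG.
have D (g : R -> R) : mu.-integrable setT (EFin \o g) -> measurable_fun setT g ->
    \int[mu]_x (pweight n.+1%:R^-1 x * g x) @[n --> \oo] --> \int[mu]_x g x.
  move=> ig mg.
  have [] := @dominated_convergence _ _ _ mu setT measurableT
    (fun n x => (pweight n.+1%:R^-1 x * g x)%:E) (fun x => (g x)%:E)
    (fun x => `|g x|%:E) _ _ _ (integrable_norm ig).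
  - move=> n; apply/measurable_EFinP.
    exact: measurable_funM (measurable_pweight _) mg.
  - exact/measurable_EFinP.
  - apply: aeW => x _; apply: cvg_EFin; first exact: nearW.
    by rewrite -[X in _ --> X]mul1r; apply: cvgM; [exact: cvg_pweight|exact: cvg_cst].
  - apply: aeW => x n _; rewrite /= lee_fin normrM ler_piMl//.
    by rewrite ger0_norm ?pweight_le1// ltW// pweight_gt0.
  move=> iGg _ cG; apply: fine_cvg; rewrite fineK//.
  exact: (integrable_fin_num measurableT iGg).
split=> /=.
  under eq_fun do under eq_Rintegral do rewrite cReM /= mul0r subr0.
  exact: D iG.1 mG.1.
under eq_fun do under eq_Rintegral do rewrite cImM /= mul0r addr0.
exact: D iG.2 mG.2.
Qed.

Variable dx : R.
Hypothesis dx0 : 0 < dx.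

(** By [fourier_cell], this is the transform of the step function with value [d j] on cell [j] for
    [j] in [s]. *)
Definition chisum (s : seq int) (d : int -> R[i]) (xi : R) : R[i] :=
  \sum_(j <- s) d j * (chi dx j xi)^*.

Lemma cmeas_chisum s d : cmeas (chisum s d).
Proof.
apply: cmeas_sum => j; apply: cmeasM; first exact: cmeas_cst.
by apply: cmeas_conj; exact: cmeas_chi.
Qed.

(** Plancherel for step functions, in Abel form. One factor of |chisum|^2 is kept as the transform
    of the step function, the other is expanded into the [chi]; each term then converges by
    [ccvg_fourier_cell], and disjointness of the cells leaves only the diagonal. *)
Lemma pweight_chisum_cvg (s : seq int) (d : int -> R[i]) : uniq s ->
  \int[mu]_x (pweight n.+1%:R^-1 x * cmod (chisum s d x) ^+ 2) @[n --> \oo] -->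
  2 * pi * dx * \sum_(j <- s) cmod (d j) ^+ 2.
Proof.
move=> us; pose fd x := \sum_(j <- s) d j * jcell dx j x.
have ij j : cintegrable (fun x => d j * jcell dx j x).
  by apply: cintegrableZ; exact: cintegrable_cell.
have ifd : cintegrable fd by exact: cintegrable_sum.
have ffd xi : fourier fd xi = chisum s d xi.
  rewrite /fourier /fd; under eq_fun do rewrite mulr_suml.
  have ie : cmeas (fun x : R => expi (- (x * xi)) : R[i]).
    apply: cmeas_expi; apply: measurableT_comp => //.
    exact: measurable_funM.
  have e1 (x : R) : cmod (expi (- (x * xi)) : R[i]) <= 1 by rewrite cmod_expi.
  rewrite cint_sum; last by move=> j; exact: cintegrableM (ij j) ie e1.
  apply: eq_bigr => j _.
  under eq_fun do rewrite -mulrA; rewrite cintZ; last first.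
    exact: cintegrableM (cintegrable_cell _ _) ie e1.
  by congr (_ * _); exact: fourier_cell.
have key : ccvg (fun n => cint (fun x =>
      (pweight n.+1%:R^-1 x * cmod (chisum s d x) ^+ 2)%:C))
    ((2 * pi * dx * \sum_(j <- s) cmod (d j) ^+ 2)%:C).
  rewrite mulrC mulr_suml rmorph_sum /=.
  have -> : (\sum_(i <- s) (cmod (d i) ^+ 2 * (2 * pi * dx))%:C) =
     \sum_(k <- s) (d k)^* * ((2 * pi)%:C * cint (fun x => fd x * jcell dx k x)).
    apply: eq_big_seq => k ks.
    under eq_fun do rewrite mulr_suml.
    under eq_fun do under eq_bigr do rewrite -mulrA.
    have ijk j : cintegrable (fun x => jcell dx j x * jcell dx k x).
      apply: (@cintegrableM _ _ _ 1) => //; first exact: cintegrable_cell.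
        exact: cintegrable_cmeas (cintegrable_cell _ _).
      by move=> x; rewrite cmod_real indicE; case: (_ \in _);
        rewrite ?normr0 ?normr1 ?lexx ?ler01.
    rewrite cint_sum; last by move=> j; exact: cintegrableZ.
    under eq_bigr do rewrite cintZ// cint_jcellM//.
    rewrite (bigD1_seq k)//= eqxx big1 ?addr0; last first.
      by move=> j jk; rewrite (negbTE jk) mulr0.
    transitivity ((2 * pi)%:C * dx%:C * (d k * (d k)^*)); last by ring.
    by rewrite mulr_conj -!rmorphM /= mulrC.
  have -> : (fun n => cint (fun x =>
      (pweight n.+1%:R^-1 x * cmod (chisum s d x) ^+ 2)%:C)) =
    (fun n => \sum_(k <- s) (d k)^* * cint (fun x => (pweight n.+1%:R^-1 x)%:C *
       (fourier fd x * chi dx k x))).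
    apply/funext => n.
    have ik k : cintegrable (fun x => (pweight n.+1%:R^-1 x)%:C *
       (fourier fd x * chi dx k x)).
      have [M hM] := cellhat_bounded (k%:~R * dx) dx.
      apply: (cintegrableM (M := (2 * \int[mu]_x cmod (fd x)) * M)).
      - by apply: cintegrable_pweight; rewrite invr_gt0.
      - by apply: cmeasM; [exact: cmeas_fourier|exact: cmeas_chi].
      - move=> x; rewrite cmodM; apply: ler_pM; rewrite ?cmod_ge0//.
          exact: cmod_fourier.
        exact: hM.
    under eq_bigr do rewrite -cintZ//.
    rewrite -cint_sum; last by move=> k; exact: cintegrableZ.
    congr cint; apply/funext => x; rewrite rmorphM /= -mulr_conj.
    rewrite {2}/chisum rmorph_sum /= mulr_sumr mulr_sumr.
    apply: eq_bigr => k _; rewrite ffd.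
    rewrite [X in _ * (_ * X) = _](_ : _ = (d k)^* * chi dx k x); first by ring.
    by rewrite (rmorphM (@conjc R)); congr (_ * _); exact: conjcK.
  apply: ccvg_sum => k; apply: ccvgZ; exact: ccvg_fourier_cell.
exact: key.1.
Qed.

(** The weights tend to 1 pointwise, so Fatou's lemma passes the bound from the Abel limit to the
    unweighted integral, whose finiteness is part of the conclusion. *)
Lemma csqint_chisum s d : uniq s -> csqint (chisum s d) /\
  \int[mu]_x cmod (chisum s d x) ^+ 2 <= 2 * pi * dx * \sum_(j <- s) cmod (d j) ^+ 2.
Proof.
move=> us; set L := (X in _ /\ _ <= X).
have mc2 : measurable_fun setT (fun x => cmod (chisum s d x) ^+ 2).
  by apply: cmeas_cmod2; exact: cmeas_chisum.
pose u n x := (pweight n.+1%:R^-1 x * cmod (chisum s d x) ^+ 2)%:E.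
have mu_ n : measurable_fun setT (u n).
  apply/measurable_EFinP; exact: measurable_funM (measurable_pweight _) mc2.
have u0 n x : setT x -> (0 <= u n x)%E.
  by move=> _; rewrite lee_fin mulr_ge0 ?sqr_ge0// ltW// pweight_gt0.
(* A finite sum of bounded transforms is bounded. This makes the weighted integrals finite, so that
   the real limit can be read in the extended reals. *)
have [M hM] : exists M, forall x, cmod (chisum s d x) ^+ 2 <= M.
  have [N hN] : exists N, forall x, cmod (chisum s d x) <= N.
    rewrite /chisum; elim: (s) => [|j r [N hN]].
      by exists 0 => x; rewrite big_nil cmod0.
    have [K hK] := cellhat_bounded (j%:~R * dx) dx.
    exists (cmod (d j) * K + N) => x; rewrite big_cons (le_trans (cmodD _ _))//.
    apply: lerD; last exact: hN.
    rewrite cmodM cmod_conj; apply: ler_wpM2l; [exact: cmod_ge0|exact: hK].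
  exists (N ^+ 2) => x; rewrite lerXn2r ?nnegrE ?cmod_ge0//.
  exact: le_trans (cmod_ge0 _) (hN x).
have iu n : mu.-integrable setT (u n).
  apply: (@le_integrable_real _ _ (fun x => M * pweight n.+1%:R^-1 x)).
  - exact: measurable_funM (measurable_pweight _) mc2.
  - move=> x; rewrite ger0_norm.
      by rewrite mulrC ler_wpM2r// ltW// pweight_gt0.
    by have := u0 n x I; rewrite lee_fin.
  - have n0 : 0 < n.+1%:R^-1 :> R by rewrite invr_gt0.
    exact: (integrableZl measurableT M (integrable_pweight n0)).
have FL : (\int[mu]_x (cmod (chisum s d x) ^+ 2)%:E <= L%:E)%E.
  have := fatou mu measurableT mu_ u0.
  rewrite (_ : (\int[mu]_x limn_einf (u^~ x))%E =
     (\int[mu]_x (cmod (chisum s d x) ^+ 2)%:E)%E); last first.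
    apply: eq_integral => x _; apply: (cvg_limn_einf_sup _).1.
    apply: cvg_EFin; first exact: nearW.
    rewrite -[X in _ --> X]mul1r; apply: cvgM; last exact: cvg_cst.
    exact: cvg_pweight.
  rewrite (_ : limn_einf _ = L%:E)//; apply: (cvg_limn_einf_sup _).1.
  rewrite (_ : (fun n => _) = EFin \o (fun n => \int[mu]_x
      (pweight n.+1%:R^-1 x * cmod (chisum s d x) ^+ 2))).
    apply: cvg_EFin; first exact: nearW.
    exact: pweight_chisum_cvg.
  apply/funext => n; rewrite /= /Rintegral fineK//.
  exact: (integrable_fin_num measurableT (iu n)).
have iF : mu.-integrable setT (EFin \o (fun x => cmod (chisum s d x) ^+ 2)).
  apply/integrableP; split; first exact/measurable_EFinP.
  under eq_integral do rewrite /= ger0_norm ?sqr_ge0//.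
  exact: le_lt_trans FL (ltry _).
split; first by split => //; exact: cmeas_chisum.
rewrite -lee_fin /Rintegral fineK//.
exact: (integrable_fin_num measurableT iF).
Qed.

End Bessel.

(** * Cell averages computed on the Fourier side, and their Bessel inequality *)

Section CellCoefficients.
Variables (R : realType) (dx : R).
Hypothesis dx0 : 0 < dx.
Local Notation mu := (@lebesgue_measure R).
Implicit Types (f F G : R -> R[i]).

Lemma csqint_chi j : csqint (chi dx j) /\
  \int[mu]_x cmod (chi dx j x) ^+ 2 <= 2 * pi * dx.
Proof.
have [[m1 i1] le1] := @csqint_chisum R dx dx0 [:: j] (fun=> 1) isT.
have E : (fun x => cmod (chisum dx [:: j] (fun=> 1) x) ^+ 2) =
    (fun x => cmod (chi dx j x) ^+ 2).
  by apply/funext => x; rewrite /chisum big_seq1 mul1r cmod_conj.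
move: i1 le1; rewrite E big_seq1 cmod1 expr1n mulr1 => i1 le1.
by split => //; split => //; exact: cmeas_chi.
Qed.

Definition sq2pi : R := Num.sqrt (2 * pi).

Lemma sq2pi_gt0 : 0 < sq2pi.
Proof. by rewrite sqrtr_gt0 mulr_gt0// pi_gt0. Qed.

Lemma sq2pi_sqr : sq2pi ^+ 2 = 2 * pi.
Proof. by rewrite sqr_sqrtr// mulr_ge0// pi_ge0. Qed.

(* The cell averages of the function whose Fourier transform is F. *)
Definition cellcoef F (j : int) : R[i] :=
  ((dx * sq2pi)^-1)%:C * cint (fun xi => F xi * chi dx j xi).

Lemma cellcoefD F G j : csqint F -> csqint G ->
  cellcoef (fun x => F x + G x) j = cellcoef F j + cellcoef G j.
Proof.
move=> sF sG; rewrite /cellcoef -mulrDr; congr (_ * _).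
have [sc _] := csqint_chi j.
by under eq_fun do rewrite mulrDl; rewrite cintD//; exact: csqintM.
Qed.

Lemma cellcoefZ c F j : csqint F ->
  cellcoef (fun x => c * F x) j = c * cellcoef F j.
Proof.
move=> sF; rewrite /cellcoef mulrCA; congr (_ * _).
have [sc _] := csqint_chi j.
by under eq_fun do rewrite -mulrA; rewrite cintZ//; exact: csqintM.
Qed.

Lemma cellcoef_sum I (r : seq I) (H : I -> R -> R[i]) j :
  (forall i, csqint (H i)) ->
  cellcoef (fun x => \sum_(i <- r) H i x) j = \sum_(i <- r) cellcoef (H i) j.
Proof.
move=> sH; rewrite /cellcoef -mulr_sumr; congr (_ * _).
have [sc _] := csqint_chi j.
under eq_fun do rewrite mulr_suml; rewrite cint_sum// => i; exact: csqintM.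
Qed.

Lemma cellcoef_shift F (l j : int) :
  cellcoef F (l + j) = cellcoef (fun x => expi (l%:~R * (dx * x)) * F x) j.
Proof.
rewrite /cellcoef; congr (_ * cint _); apply/funext => x.
by rewrite chiD mulrA (mulrC (F x)).
Qed.

(** Let S be the sum and P the [chisum] with coefficients [cellcoef F]. Then dx S is the integral of
    F conj(P) divided by [sq2pi]. Young's inequality bounds it by half the integral of |F|^2 plus 1
    / (4 pi) times that of |P|^2; the latter term is at most dx S / 2 by [csqint_chisum] and is
    absorbed on the left. *)
Lemma bessel_seq F (s : seq int) : uniq s -> csqint F ->
  dx * \sum_(j <- s) cmod (cellcoef F j) ^+ 2 <= \int[mu]_x cmod (F x) ^+ 2.
Proof.
move=> us sF; pose d := cellcoef F; set S := \sum_(j <- s) _.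
have [sP leP] := csqint_chisum dx0 d us.
have c0 := sq2pi_gt0; have cn : sq2pi != 0 by rewrite gt_eqF.
have dn : dx != 0 by rewrite gt_eqF.
have sPc := csqint_conj sP.
have E : (dx * S)%:C = (sq2pi^-1)%:C * cint (fun x => F x * (chisum dx s d x)^*).
  have -> : (fun x => F x * (chisum dx s d x)^*) =
     (fun x => \sum_(j <- s) (d j)^* * (F x * chi dx j x)).
    apply/funext => x; rewrite /chisum rmorph_sum mulr_sumr.
    apply: eq_bigr => j _; rewrite (rmorphM (@conjc R)) mulrCA; congr (_ * (_ * _)).
    exact: conjcK.
  have iF j : cintegrable (fun x => F x * chi dx j x).
    exact: csqintM sF (csqint_chi j).1.
  rewrite cint_sum; last by move=> j; exact: cintegrableZ.
  rewrite mulr_sumr /S mulr_sumr rmorph_sum; apply: eq_bigr => j _ /=.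
  rewrite cintZ//.
  have -> : cint (fun x => F x * chi dx j x) = (dx * sq2pi)%:C * d j.
    by rewrite /d /cellcoef mulrA -rmorphM mulfV ?mul1r// mulf_neq0.
  transitivity (dx%:C * (d j * (d j)^*)); first by rewrite mulr_conj -rmorphM.
  transitivity ((sq2pi^-1)%:C * (dx * sq2pi)%:C * (d j * (d j)^*)); last by ring.
  by rewrite -rmorphM; congr (_%:C * _); field.
have {E} : dx * S <= sq2pi^-1 * \int[mu]_x (2^-1 * (sq2pi * cmod (F x) ^+ 2 +
    sq2pi^-1 * cmod ((chisum dx s d x)^*) ^+ 2)).
  have -> : dx * S = Re ((dx * S)%:C) by [].
  rewrite E cReM [Im (_%:C)]/= mul0r subr0.
  rewrite ler_pM2l ?invr_gt0// (le_trans (ler_norm _))//.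
  apply: normr_Re_cint; first exact: csqintM.
    by move=> x; exact: mulr_cmod_le.
  exact: integrable_mulr_cmod.
have iZ (t : R) H : csqint H -> mu.-integrable setT (EFin \o (fun x => t * cmod (H x) ^+ 2)).
  by move=> sH; exact: (integrableZl measurableT t sH.2).
rewrite RintegralZl//; last first.
  exact: (integrableD measurableT (iZ _ F sF) (iZ _ _ sPc)).
rewrite RintegralD//; [|exact: iZ|exact: iZ].
rewrite !RintegralZl//; [|exact: sPc.2|exact: sF.2].
under [X in _ + _ * X]eq_Rintegral do rewrite cmod_conj.
move=> h.
have : sq2pi^-1 ^+ 2 * \int[mu]_x cmod (chisum dx s d x) ^+ 2 <= dx * S.
  rewrite exprVn sq2pi_sqr ler_pdivrMl ?mulr_gt0 ?pi_gt0//.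
  by rewrite mulrA.
have -> : dx * S = 2 * (dx * S) - dx * S by ring.
rewrite lerBlDr => h2.
move: h; rewrite mulrDr mulrDr !mulrA.
have -> : sq2pi^-1 / 2 * sq2pi = 2^-1 :> R by field.
have -> : sq2pi^-1 / 2 / sq2pi = 2^-1 * sq2pi^-1 ^+ 2 :> R by field.
move: h2; rewrite -!mulrA; lra.
Qed.

Lemma l2norm_cellcoef F : csqint F ->
  (l2norm dx (cellcoef F) <= (\int[mu]_x (cmod (F x) ^+ 2)%:E) `^ 2^-1)%E.
Proof.
move=> sF; rewrite /l2norm; apply: gt0_ler_poweR => //.
- by rewrite in_itv /= leey andbT; apply: esum_ge0 => j _; rewrite lee_fin mulr_ge0 ?sqr_ge0 ?ltW.
- by rewrite in_itv /= leey andbT; apply: integral_ge0 => x _; rewrite lee_fin sqr_ge0.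
apply: ub_ereal_sup => _ [A [fA _] <-].
rewrite fsbig_finite//= sumEFin -mulr_sumr.
have := @bessel_seq F _ (finmap.fset_uniq (fset_set A)) sF.
rewrite -lee_fin /Rintegral fineK//.
exact: (integrable_fin_num measurableT sF.2).
Qed.

(** Once the transform is in L^2 the product with [chi] is integrable, so its Abel limit is the
    integral itself; comparison with [ccvg_fourier_cell] removes the weight. *)
Lemma cint_fourier_chi f j : cintegrable f -> csqint (fourier f) ->
  cint (fun x => fourier f x * chi dx j x) =
  (2 * pi)%:C * cint (fun x => f x * jcell dx j x).
Proof.
move=> fi sf; apply: (ccvg_unique _ (ccvg_fourier_cell (j%:~R * dx) dx0 fi)).
exact: ccvg_pweight (csqintM sf (csqint_chi j).1).
Qed.

End CellCoefficients.

(** * Parseval for cell averages *)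

Section FourierL2.
Variable (R : realType).
Local Notation mu := (@lebesgue_measure R).
Implicit Types (f F G u U : R -> R[i]).

Lemma L2norm_sqr F :
  (\int[mu]_x (cmod (F x) ^+ 2)%:E = (L2norm F) `^ 2)%E.
Proof.
rewrite /L2norm poweR_Lnorm//; apply: eq_integral => x _ /=.
by rewrite ger0_norm ?cmod_ge0// powR_mulrn// cmod_ge0.
Qed.

Lemma csqintP F : cmeas F -> (L2norm F < +oo)%E -> csqint F.
Proof.
move=> mF lF; split => //; apply/integrableP; split.
  by apply/measurable_EFinP; exact: cmeas_cmod2.
under eq_integral do rewrite /= ger0_norm ?sqr_ge0//.
by rewrite L2norm_sqr; exact: poweR_lty.
Qed.

Lemma square_integrable_csqint F : square_integrable F -> csqint F.
Proof. by move=> [a b c]; exact: csqintP. Qed.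

Lemma L2norm_le F (d : R) : csqint F -> 0 <= d -> (L2norm F <= d%:E)%E ->
  \int[mu]_x cmod (F x) ^+ 2 <= d ^+ 2.
Proof.
move=> [_ iF] d0 Fd; rewrite -lee_fin /Rintegral fineK//; last first.
  exact: (integrable_fin_num measurableT iF).
rewrite L2norm_sqr -powR_mulrn// -poweR_EFin gt0_ler_poweR//.
  by rewrite in_itv /= leey andbT Lnorm_ge0.
by rewrite in_itv /= leey andbT lee_fin.
Qed.

Lemma cintegral_mkcond (D : set R) f :
  cintegral D f = cint (fun x => (\1_D x)%:C * f x).
Proof.
rewrite /cintegral; apply: eq_ReIm => /=; rewrite Rintegral_mkcond.
  apply: eq_Rintegral => x _; rewrite cReM /= mul0r subr0 patchE indicE.
  by case: ifPn => _; rewrite ?mul0r ?mul1r.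
apply: eq_Rintegral => x _; rewrite cImM /= mul0r addr0 patchE indicE.
by case: ifPn => _; rewrite ?mul0r ?mul1r.
Qed.

Definition window (A : R) u (x : R) : R[i] := (\1_(`[- A, A]%classic) x)%:C * u x.

Lemma csqint_window (A : R) : csqint (fun x : R => (\1_(`[- A, A]%classic) x)%:C : R[i]).
Proof.
split; first by apply: cmeas_real; exact: measurable_indic (measurable_itv _).
have -> : (fun x : R => cmod ((\1_(`[- A, A]%classic) x)%:C : R[i]) ^+ 2) =
    \1_(`[- A, A]%classic).
  apply/funext => x; rewrite cmod_real indicE.
  by case: (_ \in _); rewrite /= ?normr0 ?normr1 ?expr1n ?expr0n.
exact: (integrable_indic_itv (- A) A true false).
Qed.

Lemma cintegrable_window A u : csqint u -> cintegrable (window A u).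
Proof. by move=> su; exact: csqintM (csqint_window A) su. Qed.

Lemma truncated_fourierE A u xi :
  truncated_fourier A u xi = ((sq2pi R)^-1)%:C * fourier (window A u) xi.
Proof.
rewrite /truncated_fourier cintegral_mkcond; congr (_ * cint _).
apply/funext => x; rewrite /window -mulrA; congr (_ * (_ * _)).
by rewrite -mulrN -rmorphN cexp_imag.
Qed.

Variable dx : R.
Hypothesis dx0 : 0 < dx.

Lemma cint_window_jcell A u j : csqint u -> - A <= j%:~R * dx ->
  j%:~R * dx + dx <= A ->
  cint (fun x => window A u x * jcell dx j x) =
  cintegral `[j%:~R * dx, (j + 1)%:~R * dx] u.
Proof.
move=> su Aj jA; have iw := cintegrable_window A su.
have wu x : x \in `[j%:~R * dx, j%:~R * dx + dx] -> window A u x = u x.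
  rewrite in_itv /= => /andP[h1 h2]; rewrite /window indicE mem_set ?mul1r//=.
  by rewrite in_itv /= (le_trans Aj)// (le_trans h2).
under eq_fun do rewrite mulrC.
rewrite intrD mulrDl mul1r; apply: eq_ReIm.
  rewrite Re_cint_cell Rintegral_itv_bndo_bndc; last first.
    exact: integrableS (iw.1).
  by apply: eq_Rintegral => x; rewrite inE /= => /wu ->.
rewrite Im_cint_cell Rintegral_itv_bndo_bndc; last first.
  exact: integrableS (iw.2).
by apply: eq_Rintegral => x; rewrite inE /= => /wu ->.
Qed.

(** As soon as the window [-A, A] contains the cell, truncation does not change the average, and the
    identity is exact for the truncated function. The remaining part D of [U] is small in L^2 for
    large A, and Bessel at the single index [j] makes its coefficient small. *)
Lemma cell_average_fourier u U j : is_fourier u U ->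
  cell_average dx u j = cellcoef dx U j.
Proof.
move=> [/square_integrable_csqint su /square_integrable_csqint sU cv].
set a := cell_average dx u j.
have c0 := sq2pi_gt0 R; have cn : sq2pi R != 0 by rewrite gt_eqF.
have dn : dx != 0 by rewrite gt_eqF.
have key d : 0 < d -> dx * cmod (cellcoef dx U j - a) ^+ 2 <= d ^+ 2.
  move=> d0.
  pose DA (A xi : R) := U xi - truncated_fourier A u xi.
  have n1 : \forall A \near +oo%R, (L2norm (DA A) < d%:E)%E.
    have /(_ [set y | (y < d%:E)%E]) := cv; apply.
    exact: (@nbhs_open_ereal_lt R 0 (fun=> d)).
  have n2 : \forall A \near +oo%R, (- A <= j%:~R * dx) && (j%:~R * dx + dx <= A).
    near=> A; apply/andP; split; last by near: A; apply: nbhs_pinfty_ge; exact: num_real.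
    by rewrite lerNl; near: A; apply: nbhs_pinfty_ge; exact: num_real.
  have [A [Ad /andP[A1 A2]]] := filter_ex (filterI n1 n2).
  have iw := cintegrable_window A su.
  pose D := DA A.
  have mT : cmeas (truncated_fourier A u).
    rewrite (_ : truncated_fourier A u = fun xi => ((sq2pi R)^-1)%:C * fourier (window A u) xi).
      by apply: cmeasM; [exact: cmeas_cst|exact: cmeas_fourier].
    by apply/funext => xi; rewrite truncated_fourierE.
  have sD : csqint D.
    by apply: csqintP; [exact: cmeasB sU.1 mT|exact: lt_trans Ad (ltry _)].
  (* Square integrability is obtained without Plancherel: up to a factor this transform is [U] - D,
     and D has finite norm by the choice of A. *)
  have sf : csqint (fourier (window A u)).
    rewrite (_ : fourier _ = fun x => (sq2pi R)%:C * (U x + (-1) * D x)).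
      by apply/csqintZ/csqintD => //; exact: csqintZ.
    apply/funext => x; rewrite mulN1r /D /DA opprB addrCA subrr addr0 truncated_fourierE.
    by rewrite mulrA -rmorphM mulfV// mul1r.
  have E : cellcoef dx U j = cellcoef dx D j + a.
    have -> : U = fun x => D x + ((sq2pi R)^-1)%:C * fourier (window A u) x.
      by apply/funext => x; rewrite -truncated_fourierE /D /DA subrK.
    rewrite cellcoefD//; last exact: csqintZ.
    rewrite cellcoefZ//; congr (_ + _).
    rewrite /cellcoef cint_fourier_chi// cint_window_jcell// /a /cell_average.
    rewrite !mulrA -!rmorphM -sq2pi_sqr; congr (_%:C * _); field.
    by rewrite dn cn.
  have := bessel_seq dx0 (s := [:: j]) isT sD; rewrite big_seq1 E addrK => h.
  by apply: (le_trans h); apply: L2norm_le => //; exact: ltW.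
apply/esym/subr0_eq/cmod_eq0; set t := cmod _.
have t0 : 0 <= t by exact: cmod_ge0.
apply/eqP; rewrite eq_le t0 andbT leNgt; apply/negP => tp.
(* With d = sqrt dx t / 2 the estimate [key] reads dx t^2 <= dx t^2 / 4, impossible for t > 0. *)
have p : 0 < Num.sqrt dx * t / 2 by rewrite divr_gt0// mulr_gt0// sqrtr_gt0.
have := key _ p; rewrite -/t !exprMn (@sqr_sqrtr _ dx) ?(ltW dx0)//.
have q : 0 < dx * t ^+ 2 by rewrite mulr_gt0// exprn_gt0.
have -> : 2^-1 ^+ 2 = 4^-1 :> R by field.
by set y := dx * t ^+ 2 in q *; lra.
Unshelve. all: by end_near. Qed.

End FourierL2.

(** * Shift operators on square summable sequences *)

Section FiniteSums.

Lemma eq_sum_support (V : nmodType) (I : eqType) (s s' : seq I) (F : I -> V) :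
  uniq s -> uniq s' -> (forall j, F j != 0 -> (j \in s) && (j \in s')) ->
  \sum_(j <- s) F j = \sum_(j <- s') F j.
Proof.
move=> us us' sF.
have H (r r' : seq I) : (forall j, F j != 0 -> j \in r') ->
    \sum_(j <- r) F j = \sum_(j <- [seq j <- r | j \in r']) F j.
  move=> Fr'; rewrite big_filter [RHS]big_mkcond; apply: eq_bigr => j _.
  by case: ifPn => // jr'; apply/eqP; apply: contraNT jr'; exact: Fr'.
rewrite (H s s'); last by move=> j /sF /andP[].
rewrite (H s' s); last by move=> j /sF /andP[].
apply: perm_big; apply: uniq_perm; rewrite ?filter_uniq// => j.
by rewrite !mem_filter andbC.
Qed.

Lemma sum_shift (V : nmodType) (s s' : seq int) (l : int) (F : int -> V) :
  uniq s -> uniq s' -> (forall j, F j != 0 -> (j \in s) && (j - l \in s')) ->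
  \sum_(j <- s') F (j + l) = \sum_(j <- s) F j.
Proof.
move=> us us' sF; rewrite -(big_map (+%R^~ l) xpredT F); apply: eq_sum_support => //.
  by rewrite map_inj_uniq//; exact: addIr.
move=> j /sF /andP[-> js]; rewrite andbT.
by apply/mapP; exists (j - l) => //; rewrite subrK.
Qed.

Definition zwin (M : nat) : seq int := [seq i%:Z - M%:Z | i <- iota 0 (2 * M)].

Lemma zwin_uniq M : uniq (zwin M).
Proof.
by rewrite map_inj_uniq ?iota_uniq// => i j /addIr [->].
Qed.

Lemma mem_zwin M (j : int) : (j \in zwin M) = (- M%:Z <= j < M%:Z).
Proof.
apply/mapP/idP => [[k]|/andP[h1 h2]].
  by rewrite mem_iota add0n => /andP[_ iM] ->; lia.
exists `|(j + M%:Z)%R|%N; last by lia.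
by rewrite mem_iota; lia.
Qed.

End FiniteSums.

Section ShiftOperators.
Variable R : realType.
Local Notation mu := (@lebesgue_measure R).
Implicit Types (L : seq (R[i] * int)) (w z d : int -> R[i]).

(** A difference operator is a list of pairs (coefficient, offset), from which both its action and
    its symbol [osym] are computed. *)
Definition opr L w (j : int) : R[i] := \sum_(a <- L) a.1 * w (j + a.2).
Definition osym L (t : R) : R[i] := \sum_(a <- L) a.1 * expi (a.2%:~R * t).

Lemma cmeas_osym L : cmeas (osym L).
Proof.
apply: cmeas_sum => a; apply: cmeasM; first exact: cmeas_cst.
by apply: cmeas_expi; exact: measurable_funM.
Qed.

Lemma oprB L w z j : opr L (fun i => w i - z i) j = opr L w j - opr L z j.
Proof. by rewrite /opr -sumrB; apply: eq_bigr => a _; rewrite mulrBr. Qed.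

Lemma opr_sqr_le L : exists C, 0 <= C /\ forall w j,
  cmod (opr L w j) ^+ 2 <= C * \sum_(a <- L) cmod (w (j + a.2)) ^+ 2.
Proof.
rewrite /opr; elim: L => [|a L [C [C0 hC]]].
  by exists 0; split => // w j; rewrite !big_nil cmod0 expr0n mulr0.
exists (2 * cmod a.1 ^+ 2 + 2 * C); split.
  by rewrite addr_ge0// mulr_ge0// ?sqr_ge0.
move=> w j; rewrite !big_cons; have := hC w j.
set v := \sum_(_ <- _) _; set S := \sum_(_ <- _) _ => hv.
have S0 : 0 <= S by apply: sumr_ge0 => b _; exact: sqr_ge0.
set y := w _.
apply: (@le_trans _ _ (2 * (cmod a.1 * cmod y) ^+ 2 + 2 * cmod v ^+ 2)).
  apply: (@le_trans _ _ ((cmod a.1 * cmod y + cmod v) ^+ 2)).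
    rewrite lerXn2r ?nnegrE ?addr_ge0 ?mulr_ge0 ?cmod_ge0//.
    by rewrite -cmodM cmodD.
  rewrite -subr_ge0 (_ : _ - _ = (cmod a.1 * cmod y - cmod v) ^+ 2) ?sqr_ge0//.
  by ring.
rewrite [leRHS]mulrDl; apply: lerD.
  rewrite mulrDr -mulrA exprMn lerDl mulr_ge0// mulr_ge0// ?sqr_ge0//.
by rewrite -mulrA ler_wpM2l// (le_trans hv)// ler_wpM2l// lerDr sqr_ge0.
Qed.

Variable dx : R.
Hypothesis dx0 : 0 < dx.

Lemma opr_cellcoef L F j : csqint F ->
  opr L (cellcoef dx F) j = cellcoef dx (fun x => osym L (dx * x) * F x) j.
Proof.
move=> sF; have sE (l : int) : csqint (fun x => expi (l%:~R * (dx * x)) * F x).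
  apply: (csqint_le (C := 1) _ _ sF).
    apply: cmeasM sF.1; apply: cmeas_expi.
    by apply: measurable_funM => //; exact: measurable_funM.
  by move=> x; rewrite cmodM cmod_expi.
under [in RHS]eq_fun do rewrite mulr_suml.
rewrite cellcoef_sum//; last first.
  by move=> a; under eq_fun do rewrite -mulrA; exact: csqintZ.
apply: eq_bigr => a _; under eq_fun do rewrite -mulrA.
by rewrite (cellcoefZ dx0 a.1 j (sE a.2)) -(cellcoef_shift _ F) (addrC j).
Qed.

(** Reindexing each shifted sum turns the offset into a phase. The support condition says that [s]
    covers [z] and [s'] all its shifted copies, so that no term is lost at the ends of the finite
    ranges. *)
Lemma chisum_opr L z (s s' : seq int) xi : uniq s -> uniq s' ->
  (forall a j, a \in L -> z j != 0 -> (j \in s) && (j - a.2 \in s')) ->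
  chisum dx s' (opr L z) xi = osym L (dx * xi) * chisum dx s z xi.
Proof.
move=> us us' zs; rewrite /chisum /opr /osym.
under eq_bigr do rewrite mulr_suml.
rewrite exchange_big mulr_suml; apply: eq_big_seq => a aL.
rewrite mulr_sumr -(@sum_shift _ s s' a.2)//; last first.
  move=> j h; apply: (zs a j aL); apply: contraNneq h => ->.
  by rewrite mul0r mulr0.
apply: eq_bigr => j _; rewrite (addrC j) chiD.
have e1 : expi (a.2%:~R * (dx * xi)) * (expi (a.2%:~R * (dx * xi)))^* = 1 :> R[i].
  by rewrite mulr_conj cmod_expi expr1n.
rewrite [X in _ = _ * (_ * X)](_ : _ =
    (expi (a.2%:~R * (dx * xi)))^* * (chi dx j xi)^*); last first.
  by move: (expi _) (chi _ _ _) => [x y] [x' y']; apply: eq_ReIm => /=; ring.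
transitivity (a.1 * z (a.2 + j) * (chi dx j xi)^* *
  (expi (a.2%:~R * (dx * xi)) * (expi (a.2%:~R * (dx * xi)))^*)); last by ring.
by rewrite e1 mulr1.
Qed.


(** The symbol enlarges the transform at every frequency, so the Abel-weighted integrals are
    ordered; their limits are exact multiples of the two sums. The one-sided bound of
    [csqint_chisum] would not suffice. *)
Lemma opr_isometry_le L z (s s' : seq int) : uniq s -> uniq s' ->
  (forall a j, a \in L -> z j != 0 -> (j \in s) && (j - a.2 \in s')) ->
  (forall t, 1 <= cmod (osym L t)) ->
  \sum_(j <- s) cmod (z j) ^+ 2 <= \sum_(j <- s') cmod (opr L z j) ^+ 2.
Proof.
move=> us us' zs L1.
have c1 := @pweight_chisum_cvg R dx dx0 s z us.
have c2 := @pweight_chisum_cvg R dx dx0 s' (opr L z) us'.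
rewrite -(ler_pM2l (_ : 0 < 2 * pi * dx)); last by rewrite !mulr_gt0// pi_gt0.
have [[m1 i1] _] := csqint_chisum dx0 z us.
have [[m2 i2] _] := csqint_chisum dx0 (opr L z) us'.
have iw (s0 : seq int) d0 n :
    mu.-integrable setT (EFin \o (fun x => cmod (chisum dx s0 d0 x) ^+ 2)) ->
    measurable_fun setT (fun x => cmod (chisum dx s0 d0 x) ^+ 2) ->
    mu.-integrable setT (EFin \o (fun x => pweight n.+1%:R^-1 x * cmod (chisum dx s0 d0 x) ^+ 2)).
  move=> i0 mm; apply: le_integrable_real i0.
    exact: measurable_funM (measurable_pweight _) mm.
  move=> x; rewrite normrM (ger0_norm (sqr_ge0 _)) ler_piMl ?sqr_ge0//.
  by rewrite ger0_norm ?pweight_le1// ltW// pweight_gt0.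
apply: ler_cvg_to c1 c2 _; apply: nearW => n; apply: le_Rintegral => //.
- by apply: iw => //; exact: cmeas_cmod2.
- by apply: iw => //; exact: cmeas_cmod2.
move=> x _; rewrite ler_wpM2l ?(ltW (pweight_gt0 _ _))//.
rewrite (chisum_opr (L := L) (z := z) x us us' zs) cmodM exprMn ler_peMl ?sqr_ge0//.
by rewrite exprn_ege1.
Qed.

Lemma sum_cmod_bounded d : (l2norm dx d < +oo)%E ->
  exists S : R, forall s : seq int, uniq s -> \sum_(j <- s) cmod (d j) ^+ 2 <= S.
Proof.
move=> dl; set E : \bar R := (\esum_(j in [set: int]) (dx * cmod (d j) ^+ 2)%:E)%E.
have Elt : (E < +oo)%E by apply: lty_poweRy dl; rewrite invr_eq0.
have E0 : (0 <= E)%E.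
  by apply: esum_ge0 => j _; rewrite lee_fin mulr_ge0 ?sqr_ge0 ?ltW.
exists (dx^-1 * fine E) => s us; rewrite ler_pdivlMl//.
rewrite -lee_fin fineK ?ge0_fin_numE//.
apply: esum_ge; exists [set` s]; first by split => //; exact: finite_seq.
by rewrite -fsbig_seq// mulr_sumr sumEFin.
Qed.

(** Cut [d] off to a window. Inside, the operator still gives 0, so its output comes only from a
    layer near the edges, while [opr_isometry_le] bounds the whole mass of the window by that
    output. Each enlargement of the window thus adds at least a fixed fraction of the mass present;
    if some [d j0] is nonzero, the partial sums grow without bound. *)
Lemma opr_injective L d : (forall t, 1 <= cmod (osym L t)) ->
  (exists S : R, forall s, uniq s -> \sum_(j <- s) cmod (d j) ^+ 2 <= S) ->
  (forall j, opr L d j = 0) -> forall j, d j = 0.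
Proof.
move=> L1 [S hS] Ld0 j0.
apply/cmod_eq0; apply/eqP; rewrite -[_ == 0](expf_eq0 _ 2) /=.
(* [B] exceeds every offset in absolute value, so one application of [opr L] mixes only indices at
   distance less than [B]. *)
pose B := (\sum_(a <- L) `|a.2|%N).+1%N.
have hB a : a \in L -> (`|a.2| < B)%N.
  by move=> aL; rewrite ltnS (big_rem a)//= leq_addr.
clearbody B; pose A M : R := \sum_(j <- zwin M) cmod (d j) ^+ 2.
have [C [C0 hC]] := opr_sqr_le L.
pose K : R := C * (size L)%:R.
have step m : A (m + 2 * B)%N <= K * (A (m + 2 * B)%N - A m).
  pose z j := if j \in zwin (m + 2 * B) then d j else 0.
  (* The edge layer of [z]. For [j] in the window of radius m + B, [opr L z] agrees with [opr L d],
     hence is 0; for other [j] the inner window is out of reach and [opr L z] agrees with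
     [opr L e]. *)
  pose e j := if j \in zwin m then 0 else z j.
  have zsup j : z j != 0 -> j \in zwin (m + 2 * B).
    by rewrite /z; case: ifPn => //; rewrite eqxx.
  have esup j : e j != 0 -> j \in zwin (m + 2 * B).
    by rewrite /e; case: ifPn => //= _; [rewrite eqxx|exact: zsup].
  have -> : A (m + 2 * B)%N = \sum_(j <- zwin (m + 2 * B)) cmod (z j) ^+ 2.
    by apply: eq_big_seq => j js; rewrite /z js.
  have sh a j : a \in L -> j \in zwin (m + 2 * B) -> j - a.2 \in zwin (m + 3 * B).
    by move=> /hB h; rewrite !mem_zwin; lia.
  apply: (le_trans (@opr_isometry_le L z _ (zwin (m + 3 * B)) (zwin_uniq _) (zwin_uniq _) _ L1)).
    by move=> a j aL /zsup js; rewrite js sh.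
  have pt j : cmod (opr L z j) ^+ 2 <= C * \sum_(a <- L) cmod (e (j + a.2)) ^+ 2.
    have [jm|jm] := boolP (j \in zwin (m + B)).
      have -> : opr L z j = opr L d j.
        apply: eq_big_seq => a /hB h; rewrite /z ifT//.
        by move: jm; rewrite !mem_zwin; clear -h; move: (a.2) h => l; lia.
      rewrite Ld0 cmod0 expr0n /= mulr_ge0// sumr_ge0// => a _; exact: sqr_ge0.
    rewrite (_ : opr L z j = opr L e j); first exact: hC.
    apply: eq_big_seq => a /hB h; rewrite /e ifF//.
    by move: jm; rewrite !mem_zwin; clear -h; move: (a.2) h => l; lia.
  apply: (@le_trans _ _ (\sum_(j <- zwin (m + 3 * B))
     C * \sum_(a <- L) cmod (e (j + a.2)) ^+ 2)).
    by apply: ler_sum => j _.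
  rewrite -mulr_sumr exchange_big /=.
  have -> : \sum_(a <- L) \sum_(j <- zwin (m + 3 * B)) cmod (e (j + a.2)) ^+ 2 =
     (size L)%:R * \sum_(j <- zwin (m + 2 * B)) cmod (e j) ^+ 2.
    rewrite (_ : \sum_(a <- L) _ = \sum_(a <- L) \sum_(j <- zwin (m + 2 * B)) cmod (e j) ^+ 2).
      by rewrite big_const_seq count_predT iter_addr addr0 mulr_natl.
    apply: eq_big_seq => a aL.
    apply: (@sum_shift _ (zwin (m + 2 * B)) _ a.2 (fun j => cmod (e j) ^+ 2));
      [exact: zwin_uniq|exact: zwin_uniq|].
    move=> j h; have js : j \in zwin (m + 2 * B).
      by apply: esup; apply: contraNneq h => ->; rewrite cmod0 expr0n.
    by rewrite js sh.
  rewrite mulrA -/K ler_wpM2l ?mulr_ge0//.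
  rewrite lerBrDr.
  have -> : A m = \sum_(j <- zwin (m + 2 * B)) (if j \in zwin m then cmod (d j) ^+ 2 else 0).
    rewrite /A (eq_big_seq (fun j => if j \in zwin m then cmod (d j) ^+ 2 else 0)); last by move=> j ->.
    apply: eq_sum_support; [exact: zwin_uniq|exact: zwin_uniq|].
    move=> j; case: ifPn => [jm _|]; last by rewrite eqxx.
    by move: jm; rewrite !mem_zwin; lia.
  rewrite -big_split /=; apply: ler_sum => j _; rewrite /e.
  case: ifPn => jm; last by rewrite addr0.
  by rewrite cmod0 expr0n add0r /z ifT//; move: jm; rewrite !mem_zwin; lia.
have [->//|dn] := eqVneq (cmod (d j0)) 0; first by rewrite expr0n.
exfalso; pose del : R := cmod (d j0) ^+ 2.
have del0 : 0 < del by rewrite exprn_gt0// lt_neqAle eq_sym dn cmod_ge0.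
have Adel k : (`|j0| < k)%N -> del <= A k.
  move=> jk; have jin : j0 \in zwin k by rewrite mem_zwin; lia.
  by rewrite /A (big_rem j0)//= lerDl sumr_ge0// => i _; exact: sqr_ge0.
pose b n := A (`|j0|.+1 + n * (2 * B))%N.
(* Once the window contains [j0], each enlargement by 2 B adds at least del / K; summing n of them
   contradicts the bound [S] for large n. *)
have bstep n : n%:R * del <= K * (b n - b 0%N).
  elim: n => [|n IH]; first by rewrite mul0r subrr mulr0.
  have := step (`|j0|.+1 + n * (2 * B))%N.
  have -> : (`|j0|.+1 + n * (2 * B) + 2 * B = `|j0|.+1 + n.+1 * (2 * B))%N by lia.
  rewrite -/(b n) -/(b n.+1) => h.
  have : del <= b n.+1 by apply: Adel; lia.
  move: IH; rewrite -natr1 mulrDl mul1r !mulrBr; move: h; rewrite mulrBr; lra.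
have K0 : 0 <= K by rewrite mulr_ge0.
have b0 : 0 <= b 0%N by apply: sumr_ge0 => i _; exact: sqr_ge0.
have bS n : n%:R * del <= K * S.
  apply: le_trans (bstep n) _; rewrite ler_wpM2l// lerBlDr.
  by rewrite (le_trans (hS _ (zwin_uniq _)))// lerDl.
have := bS (Num.truncn (K * S / del)).+1.
rewrite -ler_pdivlMr// leNgt => /negP; apply.
exact: truncnS_gt.
Qed.

End ShiftOperators.

(** * Taylor bounds for sine, cosine and exp (i y) *)

Section TrigonometricBounds.
Variable R : realType.
Implicit Types x y t : R.

Lemma ge0_of_derive (f df : R -> R) : f 0 = 0 ->
  (forall x : R, is_derive x 1 f (df x)) -> (forall x, 0 <= x -> 0 <= df x) ->
  forall x, 0 <= x -> 0 <= f x.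
Proof.
move=> f0 dF df0 x x0.
have cf : {within `[0, x], continuous f}.
  apply: continuous_subspaceT => y.
  by apply: differentiable_continuous; apply/derivable1_diffP.
have [c] := MVT_segment x0 (fun y _ => dF y) cf.
rewrite in_itv /= f0 !subr0 => /andP[c0 _] ->.
by rewrite mulr_ge0// df0.
Qed.

Lemma sin_le_ge0 x : 0 <= x -> sin x <= x.
Proof.
move=> x0; rewrite -subr_ge0.
apply: (@ge0_of_derive (fun x => x - sin x) (fun x => 1 - cos x)); last exact: x0.
- by rewrite sin0 subr0.
- by move=> y _; rewrite subr_ge0 cos_le1.
Qed.

Lemma normr_sin_le x : `|sin x| <= `|x|.
Proof.
wlog x0 : x / 0 <= x.
  move=> H; have [/H//|/ltW x0] := leP 0 x.
  by rewrite -normrN -sinN -[leRHS]normrN; apply: H; rewrite oppr_ge0.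
rewrite (ger0_norm x0) ler_norml sin_le_ge0// andbT -subr_ge0 opprK.
apply: (@ge0_of_derive (fun x => sin x + x) (fun x => cos x + 1)); last exact: x0.
- by rewrite sin0 addr0.
- by move=> y _; rewrite -lerBlDr sub0r cos_geN1.
Qed.

Lemma cosE_half x : 1 - cos x = 2 * sin (x / 2) ^+ 2.
Proof.
have -> : cos x = cos (x / 2 + x / 2) by congr cos; field.
by rewrite cosD -expr2 -expr2 cos2sin2; ring.
Qed.

Lemma cos_ge x : 1 - cos x <= x ^+ 2 / 2.
Proof.
rewrite cosE_half; have := normr_sin_le (x / 2).
rewrite -(@ler_pXn2r _ 2)// ?nnegrE// !real_normK ?num_real// expr_div_n; lra.
Qed.

Lemma normr_cosB1 x : `|cos x - 1| <= x ^+ 2 / 2.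
Proof. by rewrite distrC ger0_norm ?cos_ge// subr_ge0 cos_le1. Qed.

Lemma normr_cosB1_lin x : `|cos x - 1| <= `|x|.
Proof.
rewrite distrC ger0_norm ?subr_ge0 ?cos_le1//.
have [x2|x2] := leP `|x| 2.
  apply: le_trans (cos_ge x) _; rewrite -(real_normK (num_real x)).
  have := normr_ge0 x; set a := `|x| in x2 *; nra.
by have := cos_geN1 x; lra.
Qed.

Lemma sin_cube x : `|sin x - x| <= `|x| ^+ 3 / 6.
Proof.
wlog x0 : x / 0 <= x.
  move=> H; have [/H//|/ltW x0] := leP 0 x.
  by have := H (- x); rewrite oppr_ge0 sinN -opprD !normrN; apply.
rewrite distrC (ger0_norm x0) ger0_norm ?subr_ge0 ?sin_le_ge0// -subr_ge0.
apply: (@ge0_of_derive (fun x => x ^+ 3 / 6 - (x - sin x))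
  (fun x => x ^+ 2 / 2 - (1 - cos x))); last exact: x0.
- by rewrite sin0 !subr0 expr0n /= mul0r.
- by move=> y; apply: is_derive_eq; rewrite /GRing.scale /=; field.
- by move=> y _; rewrite subr_ge0 cos_ge.
Qed.

Lemma sin_square x : `|sin x - x| <= x ^+ 2 / 2.
Proof.
wlog x0 : x / 0 <= x.
  move=> H; have [/H//|/ltW x0] := leP 0 x.
  by have := H (- x); rewrite oppr_ge0 sinN -opprD normrN sqrrN; apply.
rewrite distrC ger0_norm ?subr_ge0 ?sin_le_ge0// -subr_ge0.
apply: (@ge0_of_derive (fun x => x ^+ 2 / 2 - (x - sin x))
  (fun x => x - (1 - cos x))); last exact: x0.
- by rewrite sin0 !subr0 expr0n /= mul0r.
- by move=> y; apply: is_derive_eq; rewrite /GRing.scale /=; field.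
- move=> y y0; rewrite subr_ge0 -(ger0_norm y0) (le_trans _ (normr_cosB1_lin y))//.
  by rewrite ger0_norm// distrC ler_norm.
Qed.

Lemma expi_sub1_le y : cmod (expi y - 1) <= 2 * `|y|.
Proof.
apply: le_trans (cmod_ReIm _) _; rewrite cReD cImD cReN cImN /= subr0.
by rewrite mulr_natl mulr2n lerD ?normr_sin_le ?normr_cosB1_lin.
Qed.

Lemma expi_taylor y : cmod (expi (- y) - 1 + 'i%C * y%:C) <= y ^+ 2.
Proof.
apply: le_trans (cmod_ReIm _) _.
rewrite !(cReD, cImD, cReN, cImN, cReM, cImM) /= cosN sinN.
rewrite !(mul0r, mulr0, mul1r, add0r, subr0, subrr, addr0, oppr0).
rewrite addrC.
have -> : y ^+ 2 = y ^+ 2 / 2 + y ^+ 2 / 2 by field.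
rewrite lerD ?normr_cosB1//; last first.
by rewrite -normrN opprD opprK sin_square.
Qed.

End TrigonometricBounds.

(** * Symbols of the difference operators *)

Section Symbols.
Variables (R : realType) (p : nat) (dx : R).
Hypothesis dx0 : 0 < dx.

Definition forward_ops : seq (R[i] * int) :=
  [seq (fd_coef p dx k, p%:Z - k%:Z + 1) | k <- iota 0 (2 * p + 1).+1].
Definition backward_ops : seq (R[i] * int) :=
  [seq (fd_coef p dx k, p%:Z - k%:Z) | k <- iota 0 (2 * p + 1).+1].
Definition central_ops : seq (R[i] * int) :=
  [seq (2^-1 * a.1, a.2) | a <- forward_ops ++ backward_ops].

Lemma forward_diffE w j : forward_diff p dx w j = opr forward_ops w j.
Proof.
rewrite /forward_diff /opr big_map -(big_mkord xpredT (fun k => fd_coef p dx k * w (p%:Z - k%:Z + j + 1))).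
rewrite /index_iota subn0; apply: eq_bigr => k _ /=.
by congr (_ * w _); ring.
Qed.

Lemma backward_diffE w j : backward_diff p dx w j = opr backward_ops w j.
Proof.
rewrite /backward_diff /opr big_map -(big_mkord xpredT (fun k => fd_coef p dx k * w (p%:Z - k%:Z + j))).
rewrite /index_iota subn0; apply: eq_bigr => k _ /=.
by congr (_ * w _); ring.
Qed.

Lemma central_diffE w j : central_diff p dx w j = opr central_ops w j.
Proof.
rewrite /central_diff forward_diffE backward_diffE /opr [in RHS]big_map big_cat /=.
by rewrite mulrDr !mulr_sumr; congr (_ + _); apply: eq_bigr => a _; rewrite mulrA.
Qed.

(* The difference quotient of order 2p+1 acts on expi (t / dx * x) as
   multiplication by [half_symbol], up to a half-step shift. *)
Definition half_symbol (t : R) : R[i] :=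
  'i%C * ((-1) ^+ p * (2 * sin (t / 2) / dx) ^+ (2 * p + 1))%:C.

Lemma i_odd_power : 'i%C ^+ (2 * p + 1) = 'i%C * ((-1) ^+ p)%:C :> R[i].
Proof.
rewrite exprD exprM expr1 mulrC; congr (_ * _).
by rewrite (sqr_i R) rmorphXn /= rmorphN rmorph1.
Qed.

Lemma half_symbolE t : half_symbol t =
  ('i%C * (2 * sin (t / 2))%:C) ^+ (2 * p + 1) / ((dx ^+ (2 * p + 1))%:C).
Proof.
rewrite /half_symbol [in RHS]exprMn i_odd_power -!mulrA; congr (_ * _).
rewrite -fmorphV -rmorphXn -!rmorphM /=; congr (_%:C).
by rewrite mulrA expr_div_n.
Qed.

Lemma osym_backward_pow t : osym backward_ops t =
  expi (p%:R * t) * (1 - expi (- t)) ^+ (2 * p + 1) / ((dx ^+ (2 * p + 1))%:C).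
Proof.
rewrite /osym big_map exprBn mulr_sumr mulr_suml.
rewrite -(big_mkord xpredT (fun k => expi (p%:R * t) *
  ((-1) ^+ k * 1 ^+ (2 * p + 1 - k) * expi (- t) ^+ k *+ 'C(2 * p + 1, k)) /
    ((dx ^+ (2 * p + 1))%:C))).
rewrite /index_iota subn0; apply: eq_bigr => k _ /=.
have -> : (p%:Z - k%:Z)%:~R * t = p%:R * t + k%:R * - t :> R.
  by rewrite intrD rmorphN /= -!pmulrn; ring.
have -> : fd_coef p dx k =
    'C(2 * p + 1, k)%:R * (-1) ^+ k / (dx ^+ (2 * p + 1))%:C.
  by rewrite /fd_coef !rmorphM fmorphV rmorphXn rmorphN1 rmorph_nat.
rewrite expiD (expiMn (- t) k) expr1n mulr1 -[X in _ = _ * X / _]mulr_natr.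
by ring.
Qed.

(** Since 1 - exp (- i t) = exp (- i t / 2) 2 i sin (t / 2), the power 2p + 1 produces 2p + 1
    half-steps to one side; the offset p compensates 2p of them and one remains. The forward
    operator is one full step further, hence a half-step on the other side. *)
Lemma osym_backward t : osym backward_ops t = expi (- (t / 2)) * half_symbol t.
Proof.
rewrite osym_backward_pow half_symbolE mulrA; congr (_ / _).
have E : 1 - expi (- t) = expi (- (t / 2)) * ('i%C * (2 * sin (t / 2))%:C).
  have {1}-> : t = t / 2 + t / 2 by field.
  rewrite opprD expiD; apply: eq_ReIm; rewrite !(cReD, cImD, cReN, cImN, cReM, cImM) /=.
    rewrite cosN sinN; have := cos2Dsin2 (t / 2); set c := cos _; set s := sin _ => h.
    by rewrite -{1}h; ring.
  by rewrite cosN sinN; ring.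
rewrite E exprMn mulrA; congr (_ * _).
by rewrite -expiMn -expiD; congr expi; rewrite natrD natrM; field.
Qed.

Lemma osym_forward t : osym forward_ops t = expi (t / 2) * half_symbol t.
Proof.
have -> : osym forward_ops t = expi t * osym backward_ops t.
  rewrite /osym !big_map mulr_sumr; apply: eq_bigr => k _ /=.
  by rewrite mulrCA -expiD; congr (_ * expi _); rewrite intrD; ring.
by rewrite osym_backward mulrA -expiD; congr (expi _ * _); field.
Qed.

(** Averaging the two opposite half-steps leaves the real factor cos (t / 2), so the symbol is
    purely imaginary. *)
Lemma osym_central t : osym central_ops t = (cos (t / 2))%:C * half_symbol t.
Proof.
rewrite /osym big_map big_cat /=.
have -> : \sum_(a <- forward_ops) 2^-1 * a.1 * expi (a.2%:~R * t) =
    2^-1 * osym forward_ops t.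
  by rewrite mulr_sumr; apply: eq_bigr => a _; rewrite mulrA.
have -> : \sum_(a <- backward_ops) 2^-1 * a.1 * expi (a.2%:~R * t) =
    2^-1 * osym backward_ops t.
  by rewrite mulr_sumr; apply: eq_bigr => a _; rewrite mulrA.
rewrite osym_forward osym_backward -mulrDr -mulrDl mulrA; congr (_ * _).
have -> : expi (t / 2) + expi (- (t / 2)) = 2 * (cos (t / 2))%:C.
  by rewrite /expi cosN sinN; apply: eq_ReIm; rewrite !(cReD, cImD, cReM, cImM) /=; ring.
by rewrite mulrA mulVf ?mul1r// (_ : 2 = 2%:R)// pnatr_eq0.
Qed.

End Symbols.

(** * Stability and local error of one step of the theta-scheme *)

Section Amplification.
Variable R : realType.
Implicit Types (theta y c : R) (z g E : R[i]).

(** Here [z] stands for dt times a symbol; [ampA] and [ampB] are then the symbols of the implicit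
    and explicit sides of a step. *)
Definition ampA theta z : R[i] := 1 + theta%:C * z.
Definition ampB theta z : R[i] := 1 - (1 - theta)%:C * z.
Definition amp theta z : R[i] := ampB theta z / ampA theta z.

Lemma ampA_ge1 theta z : 0 <= theta -> 0 <= Re z -> 1 <= cmod (ampA theta z).
Proof.
move=> t0 z0; apply: le_trans (normr_Re _); apply: le_trans (ler_norm _).
by rewrite /ampA cReD cReM /= mul0r subr0 lerDl mulr_ge0.
Qed.

Lemma ampA_neq0 theta z : 0 <= theta -> 0 <= Re z -> ampA theta z != 0.
Proof.
move=> t0 z0; apply/eqP => A0; have := ampA_ge1 t0 z0.
by rewrite A0 cmod0 ler10.
Qed.

Lemma ampB_sqr theta z : cmod (ampB theta z) ^+ 2 =
  cmod (ampA theta z) ^+ 2 - 2 * Re z + (1 - 2 * theta) * cmod z ^+ 2.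
Proof.
rewrite !cmod_sqr /ampA /ampB !(cReD, cImD, cReN, cImN, cReM, cImM) /=; ring.
Qed.

(** By [ampB_sqr] the hypothesis says |ampB|^2 <= |ampA|^2 + c, and |ampA| >= 1 turns the additive
    slack into a factor. With c = 0 the step is a contraction; c proportional to dt gives bounded
    growth on [0, T]. *)
Lemma cmod_amp theta z c : 0 <= theta -> 0 <= Re z -> 0 <= c ->
  (1 - 2 * theta) * cmod z ^+ 2 <= 2 * Re z + c -> cmod (amp theta z) <= 1 + c.
Proof.
move=> t0 z0 c0 H; have A1 := ampA_ge1 t0 z0.
have A0 : 0 < cmod (ampA theta z) by exact: lt_le_trans A1.
rewrite /amp cmodM cmodV ler_pdivrMr//.
rewrite -(@ler_pXn2r _ 2)// ?nnegrE ?mulr_ge0 ?cmod_ge0 ?addr_ge0//.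
rewrite exprMn ampB_sqr; set a := cmod (ampA _ _) in A1 A0 *.
have a2 : 1 <= a ^+ 2 by rewrite exprn_ege1.
have : c <= c * a ^+ 2 by rewrite ler_peMr.
have : 0 <= c * c * a ^+ 2 by apply: mulr_ge0; [exact: mulr_ge0|exact: sqr_ge0].
have : 0 <= c * a ^+ 2 by apply: mulr_ge0 => //; exact: sqr_ge0.
have -> : (1 + c) ^+ 2 * a ^+ 2 = a ^+ 2 + 2 * (c * a ^+ 2) + c * c * a ^+ 2 by ring.
by move: H; lra.
Qed.

(** Telescoping: n one-step errors, each amplified at most n times by [rho]. *)
Lemma cmod_exprB E g (rho : R) n : cmod E = 1 -> 1 <= rho -> cmod g <= rho ->
  cmod (E ^+ n - g ^+ n) <= n%:R * rho ^+ n * cmod (E - g).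
Proof.
move=> E1 r1 gr; elim: n => [|n IH].
  by rewrite !expr0 subrr cmod0 !mul0r.
have -> : E ^+ n.+1 - g ^+ n.+1 = E * (E ^+ n - g ^+ n) + g ^+ n * (E - g).
  by rewrite !exprS; ring.
apply: le_trans (cmodD _ _) _; rewrite !cmodM E1 mul1r cmodX.
have r0 : 0 <= rho by exact: le_trans r1.
rewrite -[n.+1]addn1 natrD !mulrDl mul1r exprD expr1; apply: lerD.
  apply: le_trans IH _; rewrite ler_wpM2r ?cmod_ge0// ler_wpM2l//.
  by rewrite ler_peMr ?exprn_ge0.
rewrite ler_wpM2r ?cmod_ge0//.
apply: (@le_trans _ _ (rho ^+ n)).
  by rewrite lerXn2r ?nnegrE ?cmod_ge0.
by rewrite ler_peMr ?exprn_ge0.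
Qed.

(** Multiplying by [ampA], whose modulus is at least 1, removes the quotient. The numerator splits
    into the consistency error z - i y, the Taylor remainder of exp (- i y), and theta z (exp (- i
    y) - 1). *)
Lemma local_error theta z y : 0 <= theta <= 1 -> 0 <= Re z ->
  cmod (expi (- y) - amp theta z) <=
  cmod (z - 'i%C * y%:C) + y ^+ 2 + 2 * (cmod z * `|y|).
Proof.
move=> /andP[t0 t1] z0; have A1 := ampA_ge1 t0 z0; have An := ampA_neq0 t0 z0.
have -> : expi (- y) - amp theta z =
    (expi (- y) * ampA theta z - ampB theta z) / ampA theta z.
  by rewrite mulrBl mulfK.
rewrite cmodM cmodV ler_pdivrMr; last exact: lt_le_trans A1.
apply: (@le_trans _ _ (cmod (z - 'i%C * y%:C) + y ^+ 2 + 2 * (cmod z * `|y|))); last first.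
  rewrite ler_peMr// !addr_ge0 ?cmod_ge0 ?sqr_ge0// mulr_ge0// mulr_ge0 ?cmod_ge0//.
have -> : expi (- y) * ampA theta z - ampB theta z =
   (z - 'i%C * y%:C) + (expi (- y) - 1 + 'i%C * y%:C) + theta%:C * z * (expi (- y) - 1).
  by rewrite /ampA /ampB rmorphB rmorph1; ring.
apply: le_trans (cmodD _ _) _; apply: lerD.
  apply: le_trans (cmodD _ _) _; rewrite lerD2l; exact: expi_taylor.
rewrite !cmodM cmod_real ger0_norm//.
apply: (@le_trans _ _ (1 * cmod z * (2 * `|y|))).
  rewrite -(normrN y) ler_pM ?mulr_ge0 ?cmod_ge0 ?ler_wpM2r ?cmod_ge0//.
  exact: expi_sub1_le.
by rewrite mul1r mulrCA.
Qed.

End Amplification.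

(** * Consistency of the symbols and the two CFL conditions *)

Section SymbolEstimates.
Variables (R : realType) (p : nat) (dx : R).
Hypothesis dx0 : 0 < dx.
Implicit Types (xi : R) (c : R[i]).

Lemma normr_exprB_le (a b M : R) n : `|a| <= M -> `|b| <= M ->
  `|a ^+ n.+1 - b ^+ n.+1| <= n.+1%:R * M ^+ n * `|a - b|.
Proof.
move=> aM bM; have M0 : 0 <= M by exact: le_trans (normr_ge0 a) aM.
elim: n => [|n IH]; first by rewrite !expr1 expr0 !mul1r.
have -> : a ^+ n.+2 - b ^+ n.+2 = a * (a ^+ n.+1 - b ^+ n.+1) + b ^+ n.+1 * (a - b).
  by rewrite !exprS; ring.
apply: le_trans (ler_normD _ _) _; rewrite !normrM.
rewrite -[n.+2]addn1 natrD !mulrDl mul1r; apply: lerD.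
  apply: (@le_trans _ _ (M * (n.+1%:R * M ^+ n * `|a - b|))).
    by rewrite ler_pM.
  by rewrite exprS le_eqVlt; apply/orP; left; apply/eqP; ring.
by rewrite ler_wpM2r// normrX lerXn2r ?nnegrE.
Qed.

(** The discrete frequency: i [qsin xi] is the symbol of the centred difference quotient over one
    step [dx]. *)
Definition qsin xi : R := 2 * sin (dx * xi / 2) / dx.

Lemma normr_qsin xi : `|qsin xi| <= `|xi|.
Proof.
rewrite /qsin normrM normfV (gtr0_norm dx0) ler_pdivrMr// normrM.
have := normr_sin_le (dx * xi / 2).
rewrite !normrM normfV (gtr0_norm dx0) (@ger0_norm _ 2)//; lra.
Qed.

Lemma normr_qsin_dx xi : `|qsin xi| <= 2 / dx.
Proof.
rewrite /qsin normrM normfV (gtr0_norm dx0) ler_pM2r ?invr_gt0// normrM.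
by rewrite (@ger0_norm _ 2)// ler_piMr// sin_max.
Qed.

Lemma qsinB xi : qsin xi - xi = 2 / dx * (sin (dx * xi / 2) - dx * xi / 2).
Proof. by rewrite /qsin; field; rewrite gt_eqF. Qed.

Lemma qsin_err1 xi : `|qsin xi - xi| <= dx * `|xi| ^+ 2 / 4.
Proof.
rewrite qsinB normrM gtr0_norm ?divr_gt0//.
apply: (@le_trans _ _ (2 / dx * ((dx * xi / 2) ^+ 2 / 2))).
  by rewrite ler_wpM2l ?divr_ge0 ?(ltW dx0)// sin_square.
rewrite real_normK ?num_real// le_eqVlt; apply/orP; left; apply/eqP.
by field; rewrite gt_eqF.
Qed.

Lemma qsin_err2 xi : `|qsin xi - xi| <= dx ^+ 2 * `|xi| ^+ 3 / 24.
Proof.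
rewrite qsinB normrM gtr0_norm ?divr_gt0//.
apply: (@le_trans _ _ (2 / dx * (`|dx * xi / 2| ^+ 3 / 6))).
  by rewrite ler_wpM2l ?divr_ge0 ?(ltW dx0)// sin_cube.
rewrite !normrM normfV (gtr0_norm dx0) (@ger0_norm _ 2)//.
by rewrite le_eqVlt; apply/orP; left; apply/eqP; field; rewrite gt_eqF.
Qed.

(** The real number with (i xi)^(2p+1) = i [dispersion xi]. *)
Definition dispersion xi : R := (-1) ^+ p * xi ^+ (2 * p + 1).

Lemma half_symbol_qsin xi : half_symbol p dx (dx * xi) =
  'i%C * ((-1) ^+ p * qsin xi ^+ (2 * p + 1))%:C.
Proof. by []. Qed.

Lemma cmod_i : cmod ('i%C : R[i]) = 1.
Proof. by rewrite /cmod /= expr0n /= add0r expr1n sqrtr1. Qed.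

Lemma cmod_half_symbol xi :
  cmod (half_symbol p dx (dx * xi)) = `|qsin xi| ^+ (2 * p + 1).
Proof.
by rewrite half_symbol_qsin cmodM cmod_i mul1r cmod_real normrM normrX normrN1
  expr1n mul1r normrX.
Qed.

Lemma cmod_symbol_le c xi : cmod c <= 1 ->
  cmod (c * half_symbol p dx (dx * xi)) <= `|xi| ^+ (2 * p + 1).
Proof.
move=> c1; rewrite cmodM cmod_half_symbol -[leRHS]mul1r.
by rewrite ler_pM ?cmod_ge0 ?exprn_ge0// lerXn2r ?nnegrE// normr_qsin.
Qed.

Lemma cmod_symbol_dx c xi : cmod c <= 1 ->
  cmod (c * half_symbol p dx (dx * xi)) <= (2 / dx) ^+ (2 * p + 1).
Proof.
move=> c1; rewrite cmodM cmod_half_symbol -[leRHS]mul1r.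
rewrite ler_pM ?cmod_ge0 ?exprn_ge0// lerXn2r ?nnegrE ?normr_qsin_dx//.
by rewrite divr_ge0// ltW.
Qed.

(** The error splits into that of the factor [c], due to the half-step shift, and that of replacing
    [xi] by [qsin xi] in a power, where both are at most |xi| in modulus. *)
Lemma symbol_error c xi :
  cmod (c * half_symbol p dx (dx * xi) - 'i%C * (dispersion xi)%:C) <=
  cmod (c - 1) * `|xi| ^+ (2 * p + 1) +
  (2 * p + 1)%:R * `|xi| ^+ (2 * p) * `|qsin xi - xi|.
Proof.
have -> : c * half_symbol p dx (dx * xi) - 'i%C * (dispersion xi)%:C =
   'i%C * ((-1) ^+ p)%:C * ((c - 1) * (qsin xi ^+ (2 * p + 1))%:C +
     (qsin xi ^+ (2 * p + 1) - xi ^+ (2 * p + 1))%:C).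
  rewrite half_symbol_qsin /dispersion !rmorphM rmorphB /=; ring.
rewrite cmodM cmodM cmod_i mul1r cmod_real normrX normrN1 expr1n mul1r.
apply: le_trans (cmodD _ _) _; rewrite cmodM !cmod_real; apply: lerD.
  by rewrite ler_wpM2l ?cmod_ge0// normrX lerXn2r ?nnegrE// normr_qsin.
by rewrite addn1; apply: normr_exprB_le; rewrite ?normr_qsin.
Qed.

(** In each constant the first term comes from the half-step factor, by [expi_sub1_le] for [Cup] and
    [normr_cosB1] for [Ccen]; the second comes from [qsin_err1] respectively [qsin_err2]. *)
Definition Cup : R := 1 + (2 * p + 1)%:R / 4.
Definition Ccen : R := 1 / 8 + (2 * p + 1)%:R / 24.

Lemma symbol_error_upwind (s : R) xi : `|s| = 1 ->
  cmod (expi (s * (dx * xi / 2)) * half_symbol p dx (dx * xi) -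
        'i%C * (dispersion xi)%:C) <= Cup * (dx * `|xi| ^+ (2 * p + 2)).
Proof.
move=> s1; apply: le_trans (symbol_error _ _) _.
rewrite /Cup [leRHS]mulrDl mul1r; apply: lerD.
  apply: (@le_trans _ _ (2 * `|s * (dx * xi / 2)| * `|xi| ^+ (2 * p + 1))).
    by rewrite ler_wpM2r ?exprn_ge0// expi_sub1_le.
  rewrite !normrM s1 normfV (gtr0_norm dx0) (@ger0_norm _ 2)// addn2 exprS addn1.
  by rewrite le_eqVlt; apply/orP; left; apply/eqP; field.
apply: (@le_trans _ _ ((2 * p + 1)%:R * `|xi| ^+ (2 * p) * (dx * `|xi| ^+ 2 / 4))).
  by rewrite ler_wpM2l ?mulr_ge0 ?exprn_ge0// qsin_err1.
by rewrite exprD le_eqVlt; apply/orP; left; apply/eqP; field.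
Qed.

Lemma symbol_error_central xi :
  cmod ((cos (dx * xi / 2))%:C * half_symbol p dx (dx * xi) -
        'i%C * (dispersion xi)%:C) <= Ccen * (dx ^+ 2 * `|xi| ^+ (2 * p + 3)).
Proof.
apply: le_trans (symbol_error _ _) _.
rewrite /Ccen [leRHS]mulrDl; apply: lerD.
  apply: (@le_trans _ _ ((dx * xi / 2) ^+ 2 / 2 * `|xi| ^+ (2 * p + 1))).
    rewrite ler_wpM2r ?exprn_ge0//.
    have -> : (cos (dx * xi / 2))%:C - 1 = (cos (dx * xi / 2) - 1)%:C :> R[i].
      by rewrite rmorphB rmorph1.
    by rewrite cmod_real normr_cosB1.
  have -> : (dx * xi / 2) ^+ 2 = (dx * `|xi| / 2) ^+ 2.
    by rewrite !exprMn real_normK ?num_real.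
  rewrite (_ : (2 * p + 3 = 2 * p + 1 + 2)%N) ?exprD; last by lia.
  by rewrite le_eqVlt; apply/orP; left; apply/eqP; field.
apply: (@le_trans _ _ ((2 * p + 1)%:R * `|xi| ^+ (2 * p) * (dx ^+ 2 * `|xi| ^+ 3 / 24))).
  by rewrite ler_wpM2l ?mulr_ge0 ?exprn_ge0// qsin_err2.
by rewrite exprD le_eqVlt; apply/orP; left; apply/eqP; field.
Qed.

(** This is where the parity of [p] selects the scheme: the half-step direction (-1)^(p+1) cancels
    the sign (-1)^p of the symbol against i^2 = -1, leaving an even power, that is, dissipation. *)
Lemma Re_symbol_upwind xi :
  Re (expi ((-1) ^+ p.+1 * (dx * xi / 2)) * half_symbol p dx (dx * xi)) =
  dx / 2 * qsin xi ^+ (2 * p + 2).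
Proof.
have -> : qsin xi ^+ (2 * p + 2) = 2 * sin (dx * xi / 2) / dx * qsin xi ^+ (2 * p + 1).
  by rewrite addn2 exprS addn1.
rewrite half_symbol_qsin !(cReM, cImM) /=.
rewrite -signr_odd /= -(signr_odd _ p); case: (odd p) => /=;
  rewrite ?expr0 ?expr1 ?mul1r ?mulN1r ?cosN ?sinN; field; rewrite gt_eqF//.
Qed.

Lemma Re_symbol_central xi :
  Re ((cos (dx * xi / 2))%:C * half_symbol p dx (dx * xi)) = 0.
Proof. by rewrite half_symbol_qsin !(cReM, cImM) /=; ring. Qed.

(** With q = |qsin xi| it suffices that dt (1 - 2 theta) q^(2p) <= dx, and q <= 2 / dx reduces this
    to the CFL condition. The dissipation thus absorbs the explicit part without slack. *)
Lemma cfl_upwind (theta dt xi : R) : 0 < dt ->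
  dt * (1 - 2 * theta) <= dx ^+ (2 * p + 1) / 2 ^+ (2 * p) ->
  (1 - 2 * theta) * cmod (dt%:C * (expi ((-1) ^+ p.+1 * (dx * xi / 2)) *
    half_symbol p dx (dx * xi))) ^+ 2 <=
  2 * (dt * (dx / 2 * qsin xi ^+ (2 * p + 2))).
Proof.
move=> dt0 cfl; rewrite cmodM (cmodM (expi _)) cmod_expi mul1r cmod_half_symbol cmod_real gtr0_norm//.
have even_pow n : qsin xi ^+ (2 * n) = `|qsin xi| ^+ (2 * n).
  by rewrite !exprM real_normK ?num_real.
have -> : qsin xi ^+ (2 * p + 2) = `|qsin xi| ^+ (2 * p) * `|qsin xi| ^+ 2.
  by rewrite exprD even_pow real_normK ?num_real.
set q := `|qsin xi|; have q0 : 0 <= q by exact: normr_ge0.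
have qd : q <= 2 / dx by exact: normr_qsin_dx.
have key : dt * (1 - 2 * theta) * q ^+ (2 * p) <= dx.
  have [h|h] := leP (dt * (1 - 2 * theta)) 0.
    by apply: le_trans (ltW dx0); rewrite mulr_le0_ge0// exprn_ge0.
  apply: (@le_trans _ _ (dx ^+ (2 * p + 1) / 2 ^+ (2 * p) * (2 / dx) ^+ (2 * p))).
    by rewrite ler_pM ?exprn_ge0// ?(ltW h)// lerXn2r ?nnegrE// divr_ge0// ltW.
  rewrite expr_div_n exprD expr1 mulrACA.
  have d1 : dx ^+ (2 * p) != 0 by rewrite expf_neq0// gt_eqF.
  have d2 : (2 : R) ^+ (2 * p) != 0 by rewrite expf_neq0.
  by rewrite le_eqVlt; apply/orP; left; apply/eqP; field; rewrite d1 d2.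
have w0 : 0 <= dt * q ^+ 2 * q ^+ (2 * p).
  by rewrite !mulr_ge0 ?exprn_ge0// ltW.
have := ler_wpM2l w0 key.
rewrite addn1 [q ^+ (2 * p).+1]exprSr; set X := q ^+ (2 * p) => h.
have -> : (1 - 2 * theta) * (dt * (X * q)) ^+ 2 =
  dt * q ^+ 2 * X * (dt * (1 - 2 * theta) * X) by ring.
by apply: le_trans h _; rewrite le_eqVlt; apply/orP; left; apply/eqP; field.
Qed.

(** There is no dissipation to compare with, so a term of order dt is left. Its constant is 2 C0
    times 2^(4p+2) / 2^(4p), the numerator coming from the bound 2 / dx on the discrete
    frequency. *)
Lemma cfl_central (theta dt C0 xi : R) : 0 < dt -> 0 < C0 ->
  dt * (1 - 2 * theta) <= 2 * C0 * (dx ^+ (4 * p + 2) / 2 ^+ (4 * p)) ->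
  (1 - 2 * theta) * cmod (dt%:C * ((cos (dx * xi / 2))%:C *
    half_symbol p dx (dx * xi))) ^+ 2 <= 8 * C0 * dt.
Proof.
move=> dt0 C00 cfl; rewrite cmodM cmod_real (gtr0_norm dt0) exprMn.
set D := cmod _; have D0 : 0 <= D by exact: cmod_ge0.
have Dd : D ^+ 2 <= (2 / dx) ^+ (4 * p + 2).
  rewrite (_ : (4 * p + 2 = (2 * p + 1) * 2)%N) ?exprM; last by lia.
  rewrite lerXn2r ?nnegrE ?exprn_ge0 ?divr_ge0 ?(ltW dx0)//.
  by apply: cmod_symbol_dx; rewrite cmod_real cos_max.
have [h|h] := leP (dt * (1 - 2 * theta)) 0.
  apply: (@le_trans _ _ 0); last by rewrite !mulr_ge0// ltW.
  have -> : (1 - 2 * theta) * (dt ^+ 2 * D ^+ 2) = (dt * (1 - 2 * theta)) * (dt * D ^+ 2).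
    by ring.
  by rewrite mulr_le0_ge0// mulr_ge0 ?sqr_ge0// ltW.
have -> : (1 - 2 * theta) * (dt ^+ 2 * D ^+ 2) = dt * (dt * (1 - 2 * theta) * D ^+ 2).
  by ring.
rewrite mulrC ler_pM2r//.
apply: (@le_trans _ _ (2 * C0 * (dx ^+ (4 * p + 2) / 2 ^+ (4 * p)) * (2 / dx) ^+ (4 * p + 2))).
  by rewrite ler_pM ?sqr_ge0// ltW.
rewrite expr_div_n.
have d1 : dx ^+ (4 * p + 2) != 0 by rewrite expf_neq0// gt_eqF.
have d2 : (2 : R) ^+ (4 * p) != 0 by rewrite expf_neq0.
rewrite [2 ^+ (4 * p + 2)]exprD.
by rewrite le_eqVlt; apply/orP; left; apply/eqP; field; rewrite d1 d2.
Qed.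

End SymbolEstimates.

(** * The error of the scheme *)

Section AmplificationError.
Variables (R : realType) (p K : nat) (T theta dt c C1 h : R) (S : R -> R[i]).
Hypotheses (theta01 : 0 <= theta <= 1) (dt0 : 0 < dt) (c0 : 0 <= c)
  (C10 : 0 <= C1) (h0 : 0 <= h) (T0 : 0 <= T).
Hypothesis S_Re : forall xi, 0 <= Re (S xi).
Hypothesis S_cfl : forall xi,
  (1 - 2 * theta) * cmod (dt%:C * S xi) ^+ 2 <= 2 * Re (dt%:C * S xi) + c * dt.
Hypothesis S_le : forall xi, cmod (S xi) <= `|xi| ^+ (2 * p + 1).
Hypothesis S_err : forall xi,
  cmod (S xi - 'i%C * (dispersion p xi)%:C) <= C1 * (h * `|xi| ^+ K).

Definition ampl xi : R[i] := amp theta (dt%:C * S xi).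

Lemma Re_dtS xi : 0 <= Re (dt%:C * S xi).
Proof. by rewrite cReM /= mul0r subr0 mulr_ge0// ltW. Qed.

Lemma cmod_ampl xi : cmod (ampl xi) <= 1 + c * dt.
Proof.
have /andP[t0 _] := theta01; apply: cmod_amp => //; first exact: Re_dtS.
by rewrite mulr_ge0// ltW.
Qed.

Lemma ampl_exp_le n xi : n%:R * dt <= T -> cmod (ampl xi ^+ n) <= expR (c * T).
Proof.
move=> nT; rewrite cmodX; apply: (@le_trans _ _ (expR (c * dt) ^+ n)).
  rewrite lerXn2r ?nnegrE ?cmod_ge0 ?expR_ge0//.
  exact: le_trans (cmod_ampl xi) (expR_ge1Dx _).
by rewrite -expRM_natl ler_expR mulrCA ler_wpM2l.
Qed.

Definition growth : R := expR (c * T).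

Lemma growth_ge1 : 1 <= growth.
Proof. by rewrite /growth -expR0 ler_expR mulr_ge0. Qed.

(** The first term is the stability bound 1 + growth <= 2 growth. The others are T / dt local errors
    amplified by [growth]: 3 counts y^2 and 2 |z| |y| with |z|, |y| <= dt |xi|^(2p+1), and [C1] is
    the consistency constant. *)
Definition Cstab : R := 2 * growth + 3 * (T * growth) + T * C1 * growth.

Lemma Cstab_ge0 : 0 <= Cstab.
Proof.
have g0 : 0 <= growth by exact: le_trans growth_ge1.
by rewrite /Cstab !addr_ge0// !mulr_ge0.
Qed.

(** Two bounds compete: stability alone, and telescoped local errors, which gain from n dt <= T. The
    pair (h, K) is (dx, 2p+2) for the upwind schemes and (dx^2, 2p+3) for the central one. *)
Lemma ampl_error n xi : n%:R * dt <= T ->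
  cmod (expi (- (n%:R * dt * dispersion p xi)) - ampl xi ^+ n) <=
  Cstab * (Num.min 1 (dt * `|xi| ^+ (4 * p + 2)) + Num.min 1 (h * `|xi| ^+ K)).
Proof.
move=> nT; set a := dt * _; set b := h * _; set e := cmod _.
have G1 := growth_ge1; set G := growth in G1.
have a0 : 0 <= a by rewrite mulr_ge0 ?exprn_ge0// ltW.
have b0 : 0 <= b by rewrite mulr_ge0 ?exprn_ge0.
have G0 : 0 <= G by exact: le_trans G1.
have TG : 0 <= T * G by rewrite mulr_ge0.
have TCG : 0 <= T * C1 * G by rewrite !mulr_ge0.
have e2 : e <= 2 * G.
  apply: le_trans (cmodB _ _) _; rewrite cmod_expi.
  have := ampl_exp_le xi nT; rewrite -/growth -/G; lra.
have eab : e <= 3 * (T * G) * a + T * C1 * G * b.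
  have -> : e = cmod (expi (- (dt * dispersion p xi)) ^+ n - ampl xi ^+ n).
    by rewrite /e -expiMn; congr (cmod (expi _ - _)); ring.
  apply: le_trans (@cmod_exprB R _ _ (1 + c * dt) n (cmod_expi _) _ (cmod_ampl xi)) _.
    by rewrite lerDl mulr_ge0// ltW.
  have rG : (1 + c * dt) ^+ n <= G.
    apply: (@le_trans _ _ (expR (c * dt) ^+ n)).
      rewrite lerXn2r ?nnegrE ?expR_ge0 ?expR_ge1Dx//.
      by rewrite addr_ge0// mulr_ge0// ltW.
    by rewrite -expRM_natl ler_expR mulrCA ler_wpM2l.
  have loc : cmod (expi (- (dt * dispersion p xi)) - ampl xi) <= dt * (C1 * b + 3 * a).
    apply: le_trans (local_error (dt * dispersion p xi) theta01 (Re_dtS xi)) _.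
    have X : `|dt * dispersion p xi| = dt * `|xi| ^+ (2 * p + 1).
      by rewrite normrM (gtr0_norm dt0) normrM normrX normrN1 expr1n mul1r normrX.
    have x1 : cmod (dt%:C * S xi - 'i%C * (dt * dispersion p xi)%:C) <= dt * (C1 * b).
      have -> : dt%:C * S xi - 'i%C * (dt * dispersion p xi)%:C =
        dt%:C * (S xi - 'i%C * (dispersion p xi)%:C) by rewrite rmorphM /=; ring.
      by rewrite cmodM cmod_real gtr0_norm// ler_wpM2l ?S_err// ltW.
    have aE : dt * a = (dt * `|xi| ^+ (2 * p + 1)) ^+ 2.
      have ex : (4 * p + 2 = (2 * p + 1) * 2)%N by rewrite mulnDl mulnAC.
      by rewrite /a ex exprM; move: (_ ^+ (2 * p + 1)) => x; ring.
    have x2 : cmod (dt%:C * S xi) * `|dt * dispersion p xi| <= dt * a.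
      rewrite X aE expr2 ler_wpM2r ?mulr_ge0 ?exprn_ge0 ?(ltW dt0)//.
      by rewrite cmodM cmod_real gtr0_norm// ler_wpM2l// ltW.
    have x3 : (dt * dispersion p xi) ^+ 2 = dt * a.
      by rewrite -real_normK ?num_real// X aE.
    by rewrite mulrDr x3; lra.
  have rho0 : 0 <= (1 + c * dt) ^+ n.
    by rewrite exprn_ge0// addr_ge0// mulr_ge0// ltW.
  apply: (@le_trans _ _ (n%:R * G * (dt * (C1 * b + 3 * a)))).
    by rewrite ler_pM ?cmod_ge0 ?mulr_ge0// ler_wpM2l.
  have -> : n%:R * G * (dt * (C1 * b + 3 * a)) = n%:R * dt * (G * (C1 * b + 3 * a)) by ring.
  apply: (@le_trans _ _ (T * (G * (C1 * b + 3 * a)))); last first.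
    by rewrite le_eqVlt; apply/orP; left; apply/eqP; ring.
  by rewrite ler_wpM2r// mulr_ge0// addr_ge0// mulr_ge0.
have C0 := Cstab_ge0; rewrite /Cstab -/G in C0 *.
(* If a or b is at least 1, one of the minima is 1 and the stability bound suffices; otherwise the
   minima are a and b and the telescoped bound applies. *)
have [a1|a1] := leP 1 a.
  have m0 : 0 <= Num.min 1 b by rewrite le_min ler01.
  have := mulr_ge0 C0 m0; rewrite mulrDr mulr1; lra.
have [b1|b1] := leP 1 b.
  have := mulr_ge0 C0 a0; rewrite mulrDr mulr1; lra.
have p1 : 0 <= 2 * G * (a + b) by apply: mulr_ge0; [exact: mulr_ge0|exact: addr_ge0].
have p2 : 0 <= 3 * (T * G) * b by apply: mulr_ge0 => //; apply: mulr_ge0.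
have p3 : 0 <= T * C1 * G * a by exact: mulr_ge0.
by rewrite !mulrDl !mulrDr; move: p1; rewrite mulrDr; lra.
Qed.

End AmplificationError.

(** * From pointwise bounds in frequency to homogeneous norms *)

Section NormComparison.
Variable R : realType.
Local Notation mu := (@lebesgue_measure R).
Implicit Types (F G : R -> R[i]).

(** This elementary inequality replaces interpolation between Sobolev spaces: it trades the
    saturated bound for any fractional power. *)
Lemma min1_powR (a s : R) : 0 <= a -> 0 <= s <= 1 -> Num.min 1 a <= a `^ s.
Proof.
move=> a0 /andP[s0 s1]; have [a1|a1] := leP 1 a.
  apply: (@le_trans _ _ (1 `^ s)); first by rewrite powR1.
  by rewrite ge0_ler_powR// nnegrE.
have [->|an] := eqVneq a 0; first exact: powR_ge0.
by apply: ger1_powR => //; rewrite lt_neqAle eq_sym an a0 ltW.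
Qed.

Lemma poweR_half_addr (x y : \bar R) : (0 <= x)%E -> (0 <= y)%E ->
  ((x + y) `^ 2^-1 <= x `^ 2^-1 + y `^ 2^-1)%E.
Proof.
move: x y => [x| |] [y| |] // x0 y0; rewrite ?poweRyr ?addey ?addye ?leey//.
rewrite !lee_fin in x0 y0; rewrite -EFinD !poweR_EFin -EFinD lee_fin.
rewrite !powR12_sqrt ?addr_ge0//.
rewrite -(@ler_pXn2r _ 2)// ?nnegrE ?addr_ge0 ?sqrtr_ge0//.
rewrite sqrrD !sqr_sqrtr ?addr_ge0// lerD2r lerDl.
by rewrite mulrn_wge0// mulr_ge0// sqrtr_ge0.
Qed.

Lemma homogeneous_normE (s : R) F : homogeneous_norm s F =
  ((\int[mu]_xi ((`|xi| `^ s * cmod (F xi)) ^+ 2)%:E) `^ 2^-1)%E.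
Proof.
rewrite /homogeneous_norm /sobolev_norm; congr (_ `^ _)%E.
apply: eq_integral => xi _; rewrite powRr0 mul1r cmodM cmod_real.
by rewrite ger0_norm// powR_ge0.
Qed.

(** The factor sqrt 2 comes from (x + y)^2 <= 2 x^2 + 2 y^2 before integration, followed by
    subadditivity of the square root. Working in the extended reals avoids any finiteness condition
    on the norms. *)
Lemma L2_le_homogeneous (F G : R -> R[i]) (M al be s1 s2 : R) : cmeas F -> cmeas G ->
  0 <= M -> 0 <= al -> 0 <= be ->
  (forall xi, cmod (G xi) <=
     M * (al * `|xi| `^ s1 + be * `|xi| `^ s2) * cmod (F xi)) ->
  ((\int[mu]_xi (cmod (G xi) ^+ 2)%:E) `^ 2^-1 <=
   (Num.sqrt 2 * M)%:E * (al%:E * homogeneous_norm s1 F + be%:E * homogeneous_norm s2 F))%E.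
Proof.
move=> mF mG M0 al0 be0 GF.
pose P (s : R) xi := (`|xi| `^ s * cmod (F xi)) ^+ 2.
have mP s : measurable_fun setT (P s).
  apply: measurable_funX; apply: measurable_funM; last exact: cmeas_cmod.
  exact: measurableT_comp (measurable_powR s) (@normr_measurable R setT).
have P0 s xi : 0 <= P s xi by exact: sqr_ge0.
pose k al0 : R := 2 * M ^+ 2 * al0 ^+ 2.
have mkP x s : measurable_fun setT (fun xi => k x * P s xi).
  exact: measurable_funM (measurable_cst _) (mP s).
have k0 x : 0 <= k x.
  by apply: mulr_ge0; [apply: mulr_ge0 => //; exact: sqr_ge0|exact: sqr_ge0].
have GP xi : cmod (G xi) ^+ 2 <= k al * P s1 xi + k be * P s2 xi.
  apply: (@le_trans _ _ ((M * (al * `|xi| `^ s1 + be * `|xi| `^ s2) * cmod (F xi)) ^+ 2)).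
    by rewrite lerXn2r ?nnegrE ?cmod_ge0// !mulr_ge0 ?cmod_ge0// addr_ge0// mulr_ge0 ?powR_ge0.
  rewrite /k /P -subr_ge0.
  set x := `|xi| `^ s1; set y := `|xi| `^ s2; set f := cmod _.
  rewrite (_ : _ - _ = (M * f * (al * x - be * y)) ^+ 2) ?sqr_ge0//.
  by ring.
have I0 s : (0 <= \int[mu]_xi (P s xi)%:E)%E.
  by apply: integral_ge0 => xi _; rewrite lee_fin.
apply: (@le_trans _ _ (((k al)%:E * (\int[mu]_xi (P s1 xi)%:E) +
    (k be)%:E * (\int[mu]_xi (P s2 xi)%:E)) `^ 2^-1)%E).
  apply: gt0_ler_poweR; rewrite ?invr_ge0//.
  - by rewrite in_itv /= leey andbT; apply: integral_ge0 => xi _; rewrite lee_fin sqr_ge0.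
  - by rewrite in_itv /= leey andbT; apply: adde_ge0; apply: mule_ge0; rewrite ?lee_fin.
  rewrite -!ge0_integralZl_EFin//; last 4 first.
  - by move=> x _; rewrite lee_fin.
  - by apply/measurable_EFinP; exact: mP.
  - by move=> x _; rewrite lee_fin.
  - by apply/measurable_EFinP; exact: mP.
  rewrite -ge0_integralD//; last 4 first.
  - by move=> x _; rewrite -EFinM lee_fin mulr_ge0.
  - by apply/measurable_EFinP; exact: mkP.
  - by move=> x _; rewrite -EFinM lee_fin mulr_ge0.
  - by apply/measurable_EFinP; exact: mkP.
  apply: ge0_le_integral => //.
  - by move=> x _; rewrite lee_fin sqr_ge0.
  - by apply/measurable_EFinP; exact: cmeas_cmod2.
  - by apply/measurable_EFinP; exact: measurable_funD (mkP _ _) (mkP _ _).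
  - by move=> x _; rewrite -!EFinM -EFinD lee_fin.
apply: le_trans (poweR_half_addr _ _) _.
- by rewrite mule_ge0 ?lee_fin.
- by rewrite mule_ge0 ?lee_fin.
have kE x : 0 <= x -> ((k x)%:E `^ 2^-1 = (Num.sqrt 2 * M * x)%:E)%E.
  move=> x0; rewrite poweR_EFin powR12_sqrt// /k; congr (_%:E).
  rewrite -mulrA -exprMn sqrtrM// sqrtr_sqr ger0_norm ?mulr_ge0//.
  by rewrite mulrA.
have H0 s : (0 <= homogeneous_norm s F)%E by rewrite homogeneous_normE poweR_ge0.
have kI x s : 0 <= x -> (((k x)%:E * \int[mu]_xi (P s xi)%:E) `^ 2^-1 =
    (Num.sqrt 2 * M)%:E * (x%:E * homogeneous_norm s F))%E.
  move=> x0; rewrite poweRM ?lee_fin ?k0 ?I0// (kE x x0) homogeneous_normE.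
  by rewrite (EFinM _ x) muleA.
rewrite (kI al s1 al0) (kI be s2 be0) muleDr//.
by rewrite ge0_adde_def// inE mule_ge0 ?lee_fin.
Qed.

End NormComparison.

Lemma sum_cmodB_le (R : realType) (I : Type) (s : seq I) (v w : I -> R[i]) :
  \sum_(j <- s) cmod (v j - w j) ^+ 2 <=
  2 * \sum_(j <- s) cmod (v j) ^+ 2 + 2 * \sum_(j <- s) cmod (w j) ^+ 2.
Proof.
rewrite !mulr_sumr -big_split /=; apply: ler_sum => j _.
apply: (@le_trans _ _ ((cmod (v j) + cmod (w j)) ^+ 2)).
  by rewrite lerXn2r ?nnegrE ?addr_ge0 ?cmod_ge0// cmodB.
rewrite -subr_ge0 (_ : _ - _ = (cmod (v j) - cmod (w j)) ^+ 2) ?sqr_ge0//.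
by ring.
Qed.

(** * Solution of the scheme on the Fourier side, and the resulting error bound *)

Section SchemeError.
Variables (R : realType) (p K : nat) (T theta dt dx c C1 h : R).
Variable L : seq (R[i] * int).
Local Notation mu := (@lebesgue_measure R).
Local Notation S := (fun xi : R => osym L (dx * xi)).
Hypotheses (theta01 : 0 <= theta <= 1) (dt0 : 0 < dt) (dx0 : 0 < dx)
  (c0 : 0 <= c) (C10 : 0 <= C1) (h0 : 0 <= h) (T0 : 0 < T).
Hypothesis S_Re : forall t, 0 <= Re (osym L t).
Hypothesis S_cfl : forall xi,
  (1 - 2 * theta) * cmod (dt%:C * S xi) ^+ 2 <= 2 * Re (dt%:C * S xi) + c * dt.
Hypothesis S_le : forall xi, cmod (S xi) <= `|xi| ^+ (2 * p + 1).
Hypothesis S_err : forall xi,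
  cmod (S xi - 'i%C * (dispersion p xi)%:C) <= C1 * (h * `|xi| ^+ K).

Definition implicit_ops : seq (R[i] * int) :=
  (1, 0) :: [seq ((theta * dt)%:C * a.1, a.2) | a <- L].
Definition explicit_ops : seq (R[i] * int) :=
  (1, 0) :: [seq (- (((1 - theta) * dt)%:C * a.1), a.2) | a <- L].

Lemma opr_implicit w j :
  opr implicit_ops w j = w j + (theta * dt)%:C * opr L w j.
Proof.
rewrite /opr big_cons /= mul1r addr0 big_map mulr_sumr; congr (_ + _).
by apply: eq_bigr => a _; rewrite mulrA.
Qed.

Lemma opr_explicit w j :
  opr explicit_ops w j = w j - ((1 - theta) * dt)%:C * opr L w j.
Proof.
rewrite /opr big_cons /= mul1r addr0 big_map mulr_sumr -sumrN; congr (_ + _).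
by apply: eq_bigr => a _; rewrite mulNr mulrA.
Qed.

Lemma osym_implicit t : osym implicit_ops t = ampA theta (dt%:C * osym L t).
Proof.
rewrite /osym big_cons /= mulr0z mul0r expi0 mulr1 big_map /ampA; congr (_ + _).
by rewrite mulrA -rmorphM mulr_sumr; apply: eq_bigr => a _; rewrite mulrA.
Qed.

Lemma osym_explicit t : osym explicit_ops t = ampB theta (dt%:C * osym L t).
Proof.
rewrite /osym big_cons /= mulr0z mul0r expi0 mulr1 big_map /ampB; congr (_ + _).
rewrite mulrA -rmorphM mulr_sumr -sumrN; apply: eq_bigr => a _.
by rewrite mulNr mulrA.
Qed.

Lemma osym_implicit_ge1 t : 1 <= cmod (osym implicit_ops t).
Proof.
have /andP[t0 _] := theta01; rewrite osym_implicit; apply: ampA_ge1 => //.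
by rewrite cReM /= mul0r subr0 mulr_ge0// ltW.
Qed.

Local Notation g := (ampl theta dt S).

Lemma cmeas_ampl : cmeas g.
Proof.
have mS : cmeas S by apply: cmeas_comp (cmeas_osym L) _; exact: measurable_funM.
have mz (k : R) : cmeas (fun xi => k%:C * (dt%:C * S xi)).
  by apply: cmeasM; [exact: cmeas_cst|apply: cmeasM => //; exact: cmeas_cst].
apply: cmeasM.
  by apply: cmeasB; [exact: cmeas_cst|exact: mz].
by apply: cmeasV; apply: cmeasD; [exact: cmeas_cst|exact: mz].
Qed.

Lemma csqint_ampl n U : csqint U -> csqint (fun xi => g xi ^+ n * U xi).
Proof.
move=> sU; apply: (csqint_le (C := (1 + c * dt) ^+ n) _ _ sU).
  by apply: cmeasM sU.1; apply: cmeasX; exact: cmeas_ampl.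
move=> x; rewrite cmodM ler_wpM2r ?cmod_ge0// cmodX lerXn2r ?nnegrE ?cmod_ge0//.
  by rewrite addr_ge0// mulr_ge0// ltW.
exact: (@cmod_ampl R theta dt c S theta01 dt0 c0 (fun xi => S_Re (dx * xi)) S_cfl).
Qed.

(** Induction on n. The coefficients of g^(n+1) U satisfy the same implicit equation as [v n.+1],
    because [ampA] g = [ampB]; injectivity of the implicit operator identifies the two. *)
Lemma scheme_solution_fourier D u0 U v :
  (forall w j, D w j = opr L w j) -> is_fourier u0 U ->
  scheme_solution D T theta dx dt u0 v ->
  forall n, (n <= nsteps T dt)%N ->
  forall j, v n j = cellcoef dx (fun xi => g xi ^+ n * U xi) j.
Proof.
move=> DE fU [vl v0 vS]; have [_ sU _] := fU.
have {}sU := square_integrable_csqint sU.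
have /andP[t0 _] := theta01.
elim=> [_ j|n IH nN j].
  rewrite v0 (cell_average_fourier dx0 j fU); congr (cellcoef dx _ j).
  by apply/funext => xi; rewrite expr0 mul1r.
set w := cellcoef dx (fun xi => g xi ^+ n.+1 * U xi).
suff : forall j, v n.+1 j - w j = 0 by move=> /(_ j)/subr0_eq.
have sG k : csqint (fun xi => g xi ^+ k * U xi) by exact: csqint_ampl.
(* The difference is square summable: [v n.+1] by the definition of a solution, [w] by Bessel's
   inequality. *)
apply: (opr_injective dx0 osym_implicit_ge1).
  have [S1 h1] := sum_cmod_bounded dx0 (vl _ nN).
  have [S2 h2] : exists S2 : R, forall s, uniq s -> \sum_(j <- s) cmod (w j) ^+ 2 <= S2.
    apply: (sum_cmod_bounded dx0); apply: le_lt_trans (l2norm_cellcoef dx0 (sG _)) _.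
    by apply: poweR_lty; exact: (integrable_lty measurableT (sG n.+1).2).
  exists (2 * S1 + 2 * S2) => s us; apply: le_trans (sum_cmodB_le _ _ _) _.
  by rewrite lerD// ler_wpM2l ?h1 ?h2.
move=> i; rewrite oprB opr_implicit -!DE vS//.
have -> : v n = cellcoef dx (fun xi => g xi ^+ n * U xi).
  by apply/funext => k; apply: IH; exact: ltnW.
rewrite DE -opr_explicit (opr_cellcoef dx0 _ i (sG n)).
rewrite /w (opr_cellcoef dx0 _ i (sG n.+1)).
rewrite (_ : (fun xi => osym explicit_ops (dx * xi) * (g xi ^+ n * U xi)) =
  (fun xi => osym implicit_ops (dx * xi) * (g xi ^+ n.+1 * U xi))) ?subrr//.
apply/funext => xi; rewrite osym_implicit osym_explicit exprS.
have An : ampA theta (dt%:C * osym L (dx * xi)) != 0.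
  by apply: ampA_neq0 => //; rewrite cReM /= mul0r subr0 mulr_ge0// ltW.
have E : ampA theta (dt%:C * osym L (dx * xi)) * g xi =
    ampB theta (dt%:C * osym L (dx * xi)).
  by rewrite /ampl /amp mulrC divfK.
by rewrite -E; ring.
Qed.

Lemma scheme_error_bound D u0 U u v (s1 s2 al be : R) :
  (forall w j, D w j = opr L w j) -> is_fourier u0 U ->
  exact_solution p T U u ->
  scheme_solution D T theta dx dt u0 v -> 0 <= al -> 0 <= be ->
  (forall xi : R, Num.min 1 (dt * `|xi| ^+ (4 * p + 2)) <= al * `|xi| `^ s1) ->
  (forall xi : R, Num.min 1 (h * `|xi| ^+ K) <= be * `|xi| `^ s2) ->
  (linf_l2norm (nsteps T dt) dx (convergence_error dx dt u v) <=
   (Num.sqrt 2 * Cstab T c C1)%:E *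
     (al%:E * homogeneous_norm s1 U + be%:E * homogeneous_norm s2 U))%E.
Proof.
move=> DE fU ex sol al0 be0 m1 m2.
have [_ sqU _] := fU; have sU := square_integrable_csqint sqU.
apply: ub_ereal_sup => _ [n /= nN <-].
have nT : n%:R * dt <= T.
  rewrite -ler_pdivlMr//; apply: le_trans (_ : (nsteps T dt)%:R <= _).
    by rewrite ler_nat.
  by rewrite truncn_le divr_ge0// ltW.
have nT0 : 0 <= n%:R * dt <= T by rewrite nT andbT mulr_ge0// ltW.
pose E xi : R[i] := expi (- (n%:R * dt * dispersion p xi)).
have fu : is_fourier (u (n%:R * dt)) (fun xi => E xi * U xi).
  have := ex _ nT0; congr is_fourier; apply/funext => xi; congr (_ * _).
  rewrite exprMn i_odd_power /E -cexp_imag; congr cexp.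
  by rewrite rmorphN /dispersion !rmorphM !rmorphXn /=; ring.
have sE : csqint (fun xi => E xi * U xi).
  by have [_ /square_integrable_csqint] := fu.
pose F xi := E xi * U xi + (-1) * (g xi ^+ n * U xi).
have sG : csqint (fun xi => g xi ^+ n * U xi) by exact: csqint_ampl.
have sF : csqint F by apply: csqintD => //; exact: csqintZ.
have -> : convergence_error dx dt u v n = cellcoef dx F.
  apply/funext => j; rewrite /convergence_error (cell_average_fourier _ _ fu)//.
  rewrite (scheme_solution_fourier DE fU sol nN) /F cellcoefD//; last exact: csqintZ.
  by rewrite cellcoefZ// mulN1r.
apply: le_trans (l2norm_cellcoef dx0 sF) _.
have C0 : 0 <= Cstab T c C1 by exact: Cstab_ge0 (ltW T0).
apply: L2_le_homogeneous => //; [exact: sU.1|exact: sF.1|].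
move=> xi; have -> : F xi = (E xi - g xi ^+ n) * U xi by rewrite /F; ring.
rewrite cmodM ler_wpM2r ?cmod_ge0//.
apply: le_trans (ampl_error (K := K) theta01 dt0 c0 C10 h0 (ltW T0)
  (fun xi => S_Re (dx * xi)) S_cfl S_le S_err xi nT) _.
by rewrite ler_wpM2l// lerD.
Qed.

End SchemeError.

(** The exponent s = min (m, K) / K is the one for which (x^K)^s = x^(min (K, m)). The factor a^s is
    passed as [b] so that, for a = dx^2, it can be recorded as a power of dx. *)
Lemma min1_rate (R : realType) (a b x m : R) (K : nat) : (0 < K)%N -> 0 <= m ->
  0 <= a -> 0 <= x -> a `^ (Num.min m K%:R / K%:R) = b ->
  Num.min 1 (a * x ^+ K) <= b * x `^ (Num.min K%:R m).
Proof.
move=> K0 m0 a0 x0 <-; have Kp : 0 < K%:R :> R by rewrite ltr0n.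
have s01 : 0 <= Num.min m K%:R / K%:R <= 1.
  by rewrite divr_ge0 ?le_min ?m0 ?ler0n//= ler_pdivrMr// mul1r ge_min lexx orbT.
apply: le_trans (min1_powR _ s01) _; first by rewrite mulr_ge0// exprn_ge0.
rewrite powRM ?exprn_ge0// -powR_mulrn// -powRrM.
by rewrite (mulrC K%:R) divfK ?gt_eqF// minC.
Qed.

Theorem theorem2 (R : realType) (p : nat) (T theta m : R)
    (hT : 0 < T) (htheta : 0 <= theta <= 1) (htheta2 : theta != 2^-1)
    (hm : 0 <= m) :
  (* (i) *)
  (exists C : R, 0 < C /\
    forall (u0 u0hat : R -> R[i]) (u : R -> R -> R[i])
      (v : nat -> int -> R[i]) (dx dt : R),
    is_fourier u0 u0hat -> (sobolev_norm m u0hat < +oo)%E ->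
    exact_solution p T u0hat u ->
    0 < dx -> 0 < dt ->
    scheme_solution (if odd p then forward_diff p dx else backward_diff p dx)
      T theta dx dt u0 v ->
    dt * (1 - 2 * theta) <= dx ^+ (2 * p + 1) / 2 ^+ (2 * p) ->
    (linf_l2norm (nsteps T dt) dx (convergence_error dx dt u v) <=
     C%:E *
     ((dt `^ (Num.min m (4 * p + 2)%:R / (4 * p + 2)%:R))%:E *
        homogeneous_norm (Num.min (4 * p + 2)%:R m) u0hat +
      (dx `^ (Num.min m (2 * p + 2)%:R / (2 * p + 2)%:R))%:E *
        homogeneous_norm (Num.min (2 * p + 2)%:R m) u0hat))%E)
  /\
  (* (ii) *)
  (forall C0 : R, 0 < C0 ->
   exists C : R, 0 < C /\
    forall (u0 u0hat : R -> R[i]) (u : R -> R -> R[i])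
      (v : nat -> int -> R[i]) (dx dt : R),
    is_fourier u0 u0hat -> (sobolev_norm m u0hat < +oo)%E ->
    exact_solution p T u0hat u ->
    0 < dx -> 0 < dt ->
    scheme_solution (central_diff p dx) T theta dx dt u0 v ->
    dt * (1 - 2 * theta) <= 2 * C0 * (dx ^+ (4 * p + 2) / 2 ^+ (4 * p)) ->
    (linf_l2norm (nsteps T dt) dx (convergence_error dx dt u v) <=
     C%:E *
     ((dt `^ (Num.min m (4 * p + 2)%:R / (4 * p + 2)%:R))%:E *
        homogeneous_norm (Num.min (4 * p + 2)%:R m) u0hat +
      (dx `^ (2 * (Num.min m (2 * p + 3)%:R / (2 * p + 3)%:R)))%:E *
        homogeneous_norm (Num.min (2 * p + 3)%:R m) u0hat))%E).
Proof.
have Cpos c C1 : 0 <= C1 -> 0 <= c -> 0 < Num.sqrt 2 * Cstab T c C1.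
  move=> C10 c0; rewrite mulr_gt0 ?sqrtr_gt0// /Cstab.
  have g1 := growth_ge1 c0 (ltW hT).
  have g0 : 0 < growth T c by exact: lt_le_trans g1.
  by rewrite -addrA ltr_pwDl ?mulr_gt0// addr_ge0// ?mulr_ge0// ?mulr_ge0// ltW.
split=> [|C0 C00].
(* The growth rate is 0, by [cfl_upwind]. *)
- exists (Num.sqrt 2 * Cstab T 0 (Cup R p)); split.
    by apply: Cpos => //; rewrite /Cup addr_ge0// divr_ge0.
  move=> u0 U u v dx dt fU _ ex dx0 dt0 sol cfl.
  pose L := if odd p then forward_ops p dx else backward_ops p dx.
  have LE t : osym L t = expi ((-1) ^+ p.+1 * (t / 2)) * half_symbol p dx t.
    rewrite /L -signr_odd /=; case: (odd p).
      by rewrite osym_forward// expr0 mul1r.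
    by rewrite osym_backward// expr1 mulN1r.
  have n1 : `|(-1) ^+ p.+1| = 1 :> R by rewrite normrX normrN1 expr1n.
  (* Positivity is required at every angle t, whereas the symbol lemmas are stated at angles dx
     xi. *)
  have tdx t : t = dx * (t / dx) by field; rewrite gt_eqF.
  apply: (@scheme_error_bound R p (2 * p + 2) T theta dt dx 0 (Cup R p) dx L
    htheta dt0 dx0 _ _ (ltW dx0) hT _ _ _ _ _ u0 U u v _ _ _ _ _ fU ex sol) => //.
  + by rewrite /Cup addr_ge0// divr_ge0.
  + move=> t; rewrite LE {1 2}(tdx t) Re_symbol_upwind// mulr_ge0 ?divr_ge0 ?(ltW dx0)//.
    by rewrite (_ : (2 * p + 2 = (p + 1) * 2)%N) ?exprM ?sqr_ge0//; lia.
  + move=> xi; rewrite mul0r addr0 [Re (dt%:C * _)]cReM /= mul0r subr0 LE.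
    by rewrite Re_symbol_upwind// cfl_upwind.
  + move=> xi; rewrite LE; apply: cmod_symbol_le => //.
    by rewrite cmod_expi.
  + by move=> xi; rewrite LE; exact: symbol_error_upwind.
  + move=> w j; rewrite /L; case: (odd p); [exact: forward_diffE|exact: backward_diffE].
  + exact: powR_ge0.
  + exact: powR_ge0.
  + by move=> xi; apply: min1_rate => //; [lia|exact: ltW].
  + by move=> xi; apply: min1_rate => //; [lia|exact: ltW].
(* The growth rate 8 C0 is the constant left over in [cfl_central]. *)
exists (Num.sqrt 2 * Cstab T (8 * C0) (Ccen R p)); split.
  by apply: Cpos; [rewrite /Ccen addr_ge0// divr_ge0|rewrite mulr_ge0// ltW].
move=> u0 U u v dx dt fU _ ex dx0 dt0 sol cfl.
have LE t : osym (central_ops p dx) t = (cos (t / 2))%:C * half_symbol p dx t.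
  exact: osym_central.
have tdx t : t = dx * (t / dx) by field; rewrite gt_eqF.
apply: (@scheme_error_bound R p (2 * p + 3) T theta dt dx (8 * C0) (Ccen R p) (dx ^+ 2)
  (central_ops p dx) htheta dt0 dx0 _ _ (sqr_ge0 _) hT _ _ _ _ _ u0 U u v _ _ _ _ _ fU ex sol) => //.
+ by rewrite mulr_ge0// ltW.
+ by rewrite /Ccen addr_ge0// divr_ge0.
+ by move=> t; rewrite LE {1 2}(tdx t) Re_symbol_central.
+ move=> xi; rewrite [Re (dt%:C * _)]cReM /= mul0r subr0 LE Re_symbol_central mulr0 mulr0 add0r.
  exact: cfl_central.
+ move=> xi; rewrite LE; apply: cmod_symbol_le => //.
  by rewrite cmod_real cos_max.
+ by move=> xi; rewrite LE; exact: symbol_error_central.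
+ move=> w j; exact: central_diffE.
+ exact: powR_ge0.
+ exact: powR_ge0.
+ by move=> xi; apply: min1_rate => //; [lia|exact: ltW].
+ move=> xi; apply: min1_rate => //; first by lia.
    exact: sqr_ge0.
  by rewrite -powR_mulrn ?(ltW dx0)// -powRrM.
Qed.
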